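(* Let $\mathfrak{L}$ be a computable language, and let $(\mathcal{A}_n : n \in \mathbb{N})$ be a uniformly computable sequence of $\mathfrak{L}$-structures. Let $C \subseteq \mathbb{N}$ be a $\Delta_k$ cohesive set for some $k \geq 2$. Then the cohesive product $\prod_C \mathcal{A}_n$ has a $\Delta_{k+1}$ presentation.
   Context: $\Delta_k$ refers to the arithmetical hierarchy of subsets of $\mathbb{N}$. Computable languages and structures: A computable language $\mathfrak{L}$ is a countable (finite or infinite) first-order language whose relation, function and constant symbols, together with their arities, are given computably. A presentation (or copy) of a countable $\mathfrak{L}$-structure $\mathcal{M}$ is an isomorphic copy of $\mathcal{M}$ whose domain is a non-empty subset of $\mathbb{N}$. An $\mathfrak{L}$-structure with domain contained in $\mathbb{N}$ is identified with the subset of $\mathbb{N}$ encoding (as an effective join) its domain and the interpretations of all symbols of $\mathfrak{L}$; it is called computable, $\Delta_{k+1}$, etc. if this set is. A uniformly computable sequence of $\mathfrak{L}$-structures $(\mathcal{A}_n : n \in \mathbb{N})$ consists of a uniformly computable sequence $(|\mathcal{A}_n| : n \in \mathbb{N})$ of non-empty domains (subsets of $\mathbb{N}$) along with interpretations of all the symbols of $\mathfrak{L}$ in the $\mathcal{A}_n$ that are computable uniformly in $n$ and the symbol. Cohesive sets: $X \subseteq^* Y$ means $X \setminus Y$ is finite. A set $C \subseteq \mathbb{N}$ is cohesive if it is infinite and for every computably enumerable set $W$, either $C \subseteq^* W$ or $C \subseteq^* \mathbb{N} \setminus W$. Cohesive product: Let $C$ be cohesive. Let $D$ be the set of partial computable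 functions $\varphi : \mathbb{N} \to \mathbb{N}$ such that $\varphi(n) \in |\mathcal{A}_n|$ whenever $\varphi(n)$ is defined, and $C \subseteq^* \mathrm{dom}(\varphi)$. For $\varphi, \psi \in D$ let $\varphi =_C \psi$ mean $C \subseteq^* \{n : \varphi(n) \text{ and } \psi(n) \text{ are defined and equal}\}$; this is an equivalence relation, and $[\varphi]$ denotes the class of $\varphi$. The cohesive product $\prod_C \mathcal{A}_n$ is the $\mathfrak{L}$-structure with domain $\{[\varphi] : \varphi \in D\}$ where: for an $m$-ary relation symbol $R$, $R([\varphi_0], \dots, [\varphi_{m-1}])$ holds iff $C \subseteq^* \{n : \varphi_i(n) \text{ is defined for all } i<m \text{ and } R^{\mathcal{A}_n}(\varphi_0(n), \dots, \varphi_{m-1}(n))\}$; for an $m$-ary function symbol $F$, $F([\varphi_0], \dots, [\varphi_{m-1}]) = [\psi]$ where $\psi(n) \simeq F^{\mathcal{A}_n}(\varphi_0(n), \dots, \varphi_{m-1}(n))$; and a constant symbol $c$ is interpreted as $[\psi]$ where $\psi(n) = c^{\mathcal{A}_n}$ for all $n$. *)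

(* Defs.v *)
From Stdlib Require Cantor.
From HB Require Import structures.
From mathcomp Require Import all_boot.
From mathcomp Require Import boolp classical_sets functions cardinality.

Set Implicit Arguments.
Unset Strict Implicit.
Unset Printing Implicit Defensive.

Local Open Scope classical_set_scope.
Local Open Scope quotient_scope.

Definition npair (x y : nat) : nat := Cantor.to_nat (x, y).
Definition nfst (z : nat) : nat := (Cantor.of_nat z).1.
Definition nsnd (z : nat) : nat := (Cantor.of_nat z).2.

(** Programs for the partial recursive functions. All functions are unary;
    several arguments are passed through the Cantor pairing, so that
    [CPair CFst CSnd] is the identity. *)
Inductive code : Type :=
| CZero | CSucc | CFst | CSnd
| CPair of code & code
| CComp of code & code
| CPrec of code & code
| CMu of code.

(** [prec_eval E G a n y]: the function defined by primitive recursion from the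
    (graphs of the) base case [E a] and the step [G <a, <n, previous value>>]
    takes the value [y] at [n]. *)
Fixpoint prec_eval (E G : nat -> nat -> Prop) (a n y : nat) : Prop :=
  match n with
  | 0 => E a y
  | n'.+1 => exists2 z, prec_eval E G a n' z & G (npair a (npair n' z)) y
  end.

(** [eval c x y]: program [c] halts on input [x] with output [y]. *)
Fixpoint eval (c : code) (x y : nat) : Prop :=
  match c with
  | CZero => y = 0
  | CSucc => y = x.+1
  | CFst => y = nfst x
  | CSnd => y = nsnd x
  | CPair c d => exists a b, [/\ eval c x a, eval d x b & y = npair a b]
  | CComp c d => exists2 a, eval d x a & eval c a y
  | CPrec c d => prec_eval (eval c) (eval d) (nfst x) (nsnd x) y
  | CMu c => eval c (npair x y) 0 /\
             forall z, z < y -> exists v, eval c (npair x z) v.+1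
  end.

Definition partial_computable (f : nat -> option nat) : Prop :=
  exists c : code, forall x y, eval c x y <-> f x = Some y.

Definition computable_set (A : set nat) : Prop :=
  partial_computable (fun n => Some (nat_of_bool (n \in A))).

Definition ce_set (W : set nat) : Prop :=
  exists2 f, partial_computable f & W = [set n | f n].

(** A [Sigma_0] set is a computable set, and a [Sigma_(k+1)] set is the
    projection of a [Pi_k] set, i.e. of the complement of a [Sigma_k] set. *)
Fixpoint Sigma_set (k : nat) (A : set nat) : Prop :=
  match k with
  | 0 => computable_set A
  | k'.+1 => exists2 B, Sigma_set k' (~` B) &
                        A = [set x | exists y, B (npair x y)]
  end.

Definition Pi_set (k : nat) (A : set nat) : Prop := Sigma_set k (~` A).

Definition Delta_set (k : nat) (A : set nat) : Prop :=
  Sigma_set k A /\ Pi_set k A.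

(** Symbols are identified with their code numbers. *)
Record language : Type := Language {
  rel_sym : set nat;
  fun_sym : set nat;
  const_sym : set nat;
  rel_arity : rel_sym -> nat;
  fun_arity : fun_sym -> nat }.

Record computable_language (L : language) : Prop := ComputableLanguage {
  comp_rel_sym : computable_set (rel_sym L);
  comp_fun_sym : computable_set (fun_sym L);
  comp_const_sym : computable_set (const_sym L);
  comp_rel_arity : exists2 f, partial_computable f &
    forall s : rel_sym L, f (val s) = Some (rel_arity s);
  comp_fun_arity : exists2 f, partial_computable f &
    forall s : fun_sym L, f (val s) = Some (fun_arity s) }.

Record structure_on (L : language) (M : Type) : Type := StructureOn {
  rel_interp : forall s : rel_sym L, (rel_arity s).-tuple M -> Prop;
  fun_interp : forall s : fun_sym L, (fun_arity s).-tuple M -> M;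
  const_interp : const_sym L -> M }.

Definition isomorphism (L : language) (M N : Type)
    (SM : structure_on L M) (SN : structure_on L N) (f : M -> N) : Prop :=
  [/\ bijective f,
      forall (s : rel_sym L) (t : (rel_arity s).-tuple M),
        rel_interp SM t <-> rel_interp SN (map_tuple f t),
      forall (s : fun_sym L) (t : (fun_arity s).-tuple M),
        f (fun_interp SM t) = fun_interp SN (map_tuple f t) &
      forall s : const_sym L, f (const_interp SM s) = const_interp SN s].

Record nat_structure (L : language) : Type := NatStructure {
  dom :> set nat;
  dom_nonempty : dom !=set0;
  str : structure_on L dom }.

Definition presentation (L : language) (N : nat_structure L)
    (M : Type) (SM : structure_on L M) : Prop :=
  exists f : N -> M, isomorphism (str N) SM f.

Definition code_seq (s : seq nat) : nat :=
  foldr (fun x c => (npair x c).+1) 0 s.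

Definition code_args (A : set nat) (m : nat) (t : m.-tuple A) : nat :=
  code_seq [seq val a | a <- t].

(** The subset of [nat] with which a structure is identified: the effective join
    of its domain, its relations, the graphs of its functions, and its
    constants. *)
Definition diagram (L : language) (N : nat_structure L) : set nat :=
  [set x | [\/ exists a : N, x = npair 0 (val a),
      exists (s : rel_sym L) (t : (rel_arity s).-tuple N),
        rel_interp (str N) t /\ x = npair 1 (npair (val s) (code_args t)),
      exists (s : fun_sym L) (t : (fun_arity s).-tuple N),
        x = npair 2 (npair (val s)
                       (npair (code_args t) (val (fun_interp (str N) t)))) |
      exists s : const_sym L,
        x = npair 3 (npair (val s) (val (const_interp (str N) s)))]].

Definition Delta_structure (L : language) (k : nat) (N : nat_structure L) :
  Prop := Delta_set k (diagram N).

Record uniformly_computable (L : language) (A : nat -> nat_structure L) :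
    Prop := UniformlyComputable {
  uc_dom : computable_set [set x | exists n (a : A n), x = npair n (val a)];
  uc_rel : computable_set
    [set x | exists n (s : rel_sym L) (t : (rel_arity s).-tuple (A n)),
      rel_interp (str (A n)) t /\ x = npair n (npair (val s) (code_args t))];
  uc_func : exists2 f, partial_computable f &
    forall n (s : fun_sym L) (t : (fun_arity s).-tuple (A n)),
      f (npair n (npair (val s) (code_args t))) =
        Some (val (fun_interp (str (A n)) t));
  uc_const : exists2 f, partial_computable f &
    forall n (s : const_sym L),
      f (npair n (val s)) = Some (val (const_interp (str (A n)) s)) }.

Definition almost_sub (X Y : set nat) : Prop := finite_set (X `\` Y).

Definition cohesive (C : set nat) : Prop :=
  infinite_set C /\
  forall W, ce_set W -> almost_sub C W \/ almost_sub C (~` W).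

(** The set [D] of partial computable functions: the condition that [phi n] is
    in the domain of [A n] whenever it is defined is carried by the type. *)
Record cfun (L : language) (A : nat -> nat_structure L) (C : set nat) : Type :=
  CFun {
    cfun_val :> forall n, option (A n);
    cfun_comp : partial_computable (fun n => omap val (cfun_val n));
    cfun_dom : almost_sub C [set n | cfun_val n] }.

HB.instance Definition _ L (A : nat -> nat_structure L) C :=
  gen_eqMixin (cfun A C).
HB.instance Definition _ L (A : nat -> nat_structure L) C :=
  gen_choiceMixin (cfun A C).

Definition eqC_set L (A : nat -> nat_structure L) C (phi psi : cfun A C) :
    set nat :=
  [set n | exists2 a, phi n = Some a & psi n = Some a].

Definition eqC L (A : nat -> nat_structure L) C (phi psi : cfun A C) : bool :=
  `[< almost_sub C (eqC_set phi psi) >].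

Lemma almost_subS C X Y : X `<=` Y -> almost_sub C X -> almost_sub C Y.
Proof. by move=> XY; apply: sub_finite_set => n [Cn nY]; split=> // /XY. Qed.

Lemma almost_subI C X Y :
  almost_sub C X -> almost_sub C Y -> almost_sub C (X `&` Y).
Proof. by rewrite /almost_sub setDIr finite_setU. Qed.

Lemma eqC_refl L (A : nat -> nat_structure L) C : reflexive (@eqC L A C).
Proof.
move=> phi; apply/asboolP; apply: almost_subS (cfun_dom phi) => n /=.
by rewrite /eqC_set /=; case: (phi n) => // a _; exists a.
Qed.

Lemma eqC_sym L (A : nat -> nat_structure L) C : symmetric (@eqC L A C).
Proof.
move=> phi psi; apply/asboolP/asboolP;
  by apply: almost_subS => n [a]; exists a.
Qed.

Lemma eqC_trans L (A : nat -> nat_structure L) C : transitive (@eqC L A C).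
Proof.
move=> psi phi chi /asboolP e1 /asboolP e2; apply/asboolP.
apply: almost_subS (almost_subI e1 e2) => n /= [[a pa qa] [b qb cb]].
by exists a => //; move: qb; rewrite qa => -[->].
Qed.

Canonical eqC_equiv L (A : nat -> nat_structure L) C :=
  EquivRel (@eqC L A C) (@eqC_refl L A C) (@eqC_sym L A C) (@eqC_trans L A C).

Definition cprod L (A : nat -> nat_structure L) C : Type :=
  {eq_quot @eqC L A C}.

(** [Some] of the tuple of all the entries if these are all defined: [pmap id]
    drops the undefined entries and [insub] checks the remaining length. *)
Definition all_some (T : Type) m (u : m.-tuple (option T)) :
  option (m.-tuple T) := insub (pmap id u).

Definition values L (A : nat -> nat_structure L) C m
    (Phi : m.-tuple (cfun A C)) (n : nat) : option (m.-tuple (A n)) :=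
  all_some (map_tuple (fun phi : cfun A C => phi n) Phi).

Lemma all_someP (T : Type) m (u : m.-tuple (option T)) (t : m.-tuple T) :
  all_some u = Some t <-> u = map_tuple Some t.
Proof.
have pK (s : seq T) : pmap id (map Some s) = s by elim: s => //= a s ->.
rewrite /all_some; split=> [|->]; last by rewrite /= pK; exact: valK.
case: insubP => // v sv vE [<-]; apply: val_inj => /=; rewrite {}vE.
move: sv; rewrite size_pmap -{2}(size_tuple u) -all_count.
by elim: (tval u) => //= -[a|] s IH //= /IH <-.
Qed.

Lemma valuesP L (A : nat -> nat_structure L) C m (Phi : m.-tuple (cfun A C)) n
    (t : m.-tuple (A n)) :
  values Phi n = Some t <-> forall i, tnth Phi i n = Some (tnth t i).
Proof.
rewrite /values all_someP; split=> [E i|E].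
  have := congr1 (fun u : m.-tuple _ => tnth u i) E.
  by rewrite !tnth_map.
by apply: eq_from_tnth => i; rewrite !tnth_map E.
Qed.

Lemma almost_sub_values L (A : nat -> nat_structure L) C m
    (Phi : m.-tuple (cfun A C)) : almost_sub C [set n | values Phi n].
Proof.
have : almost_sub C [set n | all (fun phi : cfun A C => isSome (phi n)) Phi].
  elim: (tval Phi) => [|phi s IH].
    by rewrite /almost_sub (_ : _ `\` _ = set0) // -subset0 => n [_ []].
  by apply: almost_subS (almost_subI (cfun_dom phi) IH) => n /= [-> ->].
apply: almost_subS => n /= Hn.
suff [t E] : exists t, values Phi n = Some t by rewrite E.
have d i : {a | tnth Phi i n = Some a}.
  move/allP: Hn => /(_ _ (mem_tnth i Phi)).
  by case: (tnth Phi i n) => // a _; exists a.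
by exists [tuple sval (d i) | i < m]; apply/valuesP => i;
   rewrite tnth_mktuple; exact: (svalP (d i)).
Qed.

Lemma pc_id : partial_computable (fun n => Some n).
Proof.
exists (CPair CFst CSnd) => x y /=; split=> [[a [b [-> -> ->]]]|[<-]].
  by rewrite /npair -surjective_pairing Cantor.cancel_to_of.
by exists (nfst x), (nsnd x); rewrite /npair -surjective_pairing
   Cantor.cancel_to_of.
Qed.

Lemma pc_const k : partial_computable (fun=> Some k).
Proof.
elim: k => [|k [c Hc]]; first by exists CZero => x y /=; split=> [->|[]].
exists (CComp CSucc c) => x y /=; split=> [[a /Hc[<-] ->]//|[<-]].
by exists k => //; apply/Hc.
Qed.

Lemma pc_comp f g : partial_computable f -> partial_computable g ->
  partial_computable (fun n => obind g (f n)).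
Proof.
move=> [c Hc] [d Hd]; exists (CComp d c) => x y /=; split.
  by move=> [a /Hc-> /Hd].
by case E: (f x) => [a|] //= /Hd Hy; exists a => //; apply/Hc.
Qed.

Lemma pc_pair f g : partial_computable f -> partial_computable g ->
  partial_computable
    (fun n => obind (fun a => omap (npair a) (g n)) (f n)).
Proof.
move=> [c Hc] [d Hd]; exists (CPair c d) => x y /=; split.
  by move=> [a [b [/Hc-> /Hd-> ->]]].
case E: (f x) => [a|] //=; case F: (g x) => [b|] //= [<-].
by exists a, b; split=> //; [apply/Hc|apply/Hd].
Qed.

Lemma pc_values L (A : nat -> nat_structure L) C m
    (Phi : m.-tuple (cfun A C)) :
  partial_computable (fun n => omap (@code_args _ m) (values Phi n)).
Proof.
elim: m Phi => [|m IH] Phi.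
  rewrite (_ : (fun _ => _) = fun=> Some 0); first exact: pc_const.
  apply/funext => n.
  by have /valuesP-> : forall i, tnth Phi i n = Some (tnth [tuple] i) by case.
case/tupleP: Phi => phi Phi.
have cS : partial_computable (fun n => Some n.+1).
  by exists CSucc => x y; split=> [->|[]].
have := pc_comp (pc_pair (cfun_comp phi) (IH Phi)) cS.
congr partial_computable; apply/funext => x.
case Ep : (phi x) => [a|] /=; last first.
  case E : (values _ x) => [t|] //=; move/valuesP: E => /(_ ord0).
  by rewrite tnth0 Ep.
case Ev : (values Phi x) => [t|] /=.
  have -> // : values [tuple of phi :: Phi] x = Some [tuple of a :: t].
  apply/valuesP => i; case: (unliftP ord0 i) => [j|] ->; rewrite ?tnth0 //.
  by rewrite !tnthS; move/valuesP: Ev.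
case E : (values _ x) => [t|] //=; case/tupleP: t E => b t /valuesP E.
suff : values Phi x = Some t by rewrite Ev.
by apply/valuesP => i; have := E (lift ord0 i); rewrite !tnthS.
Qed.

Lemma cprod_fun_comp L (A : nat -> nat_structure L) C
    (hA : uniformly_computable A) (s : fun_sym L)
    (Phi : (fun_arity s).-tuple (cfun A C)) :
  partial_computable (fun n =>
    omap val (omap (fun_interp (str (A n)) (s := s)) (values Phi n))).
Proof.
have [f cf fE] := uc_func hA.
have := pc_comp (pc_pair pc_id (pc_pair (pc_const (val s)) (pc_values Phi))) cf.
congr partial_computable; apply/funext => n /=.
by case: (values Phi n) => //= t; rewrite fE.
Qed.

Lemma cprod_fun_dom L (A : nat -> nat_structure L) C (s : fun_sym L)
    (Phi : (fun_arity s).-tuple (cfun A C)) :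
  almost_sub C [set n |
    isSome (omap (fun_interp (str (A n)) (s := s)) (values Phi n))].
Proof.
by apply: almost_subS (almost_sub_values Phi) => n /=; case: (values Phi n).
Qed.

Lemma cprod_const_comp L (A : nat -> nat_structure L)
    (hA : uniformly_computable A) (s : const_sym L) :
  partial_computable (fun n => omap val (Some (const_interp (str (A n)) s))).
Proof.
have [f cf fE] := uc_const hA.
have := pc_comp (pc_pair pc_id (pc_const (val s))) cf.
by congr partial_computable; apply/funext => n; rewrite /= fE.
Qed.

Lemma cprod_const_dom L (A : nat -> nat_structure L) (C : set nat)
    (s : const_sym L) :
  almost_sub C [set n | isSome (Some (const_interp (str (A n)) s))].
Proof. by rewrite /almost_sub (_ : _ `\` _ = set0) // -subset0 => n [_ []]. Qed.

Definition cfun_rel L (A : nat -> nat_structure L) C (s : rel_sym L)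
    (Phi : (rel_arity s).-tuple (cfun A C)) : Prop :=
  almost_sub C [set n |
    exists2 t, values Phi n = Some t & rel_interp (str (A n)) t].

Definition cfun_fun L (A : nat -> nat_structure L) C
    (hA : uniformly_computable A) (s : fun_sym L)
    (Phi : (fun_arity s).-tuple (cfun A C)) : cfun A C :=
  CFun (cprod_fun_comp hA Phi) (cprod_fun_dom Phi).

Definition cfun_const L (A : nat -> nat_structure L) C
    (hA : uniformly_computable A) (s : const_sym L) : cfun A C :=
  CFun (cprod_const_comp hA s) (@cprod_const_dom L A C s).

(** Relations and functions are computed on representatives; by [cprod_relE]
    and [cprod_funE] below any other representatives give the same result. *)
Definition cohesive_product L (A : nat -> nat_structure L)
    (hA : uniformly_computable A) (C : set nat) : structure_on L (cprod A C) :=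
  {| rel_interp s X := cfun_rel (map_tuple repr X);
     fun_interp s X := \pi_(cprod A C) (cfun_fun hA (map_tuple repr X));
     const_interp s := \pi_(cprod A C) (cfun_const C hA s) |}.

Lemma cprod_eqP L (A : nat -> nat_structure L) C (phi psi : cfun A C) :
  \pi_(cprod A C) phi = \pi_(cprod A C) psi <->
  almost_sub C (eqC_set phi psi).
Proof. by split=> [/eqmodP/asboolP|?]; last exact/eqmodP/asboolP. Qed.

Lemma almost_values_repr L (A : nat -> nat_structure L) C m
    (Phi : m.-tuple (cfun A C)) :
  almost_sub C [set n | exists2 t, values Phi n = Some t &
    values (map_tuple (fun phi => repr (\pi_(cprod A C) phi)) Phi) n = Some t].
Proof.
have : almost_sub C [set n | forall phi, phi \in tval Phi ->
    eqC_set phi (repr (\pi_(cprod A C) phi)) n].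
  elim: (tval Phi) => [|phi s IH].
    by rewrite /almost_sub (_ : _ `\` _ = set0) // -subset0 => n [_ []].
  have /cprod_eqP e : \pi_(cprod A C) phi =
    \pi_(cprod A C) (repr (\pi_(cprod A C) phi)) by rewrite reprK.
  apply: almost_subS (almost_subI e IH) => n /= [en IHn] psi.
  by rewrite inE => /orP[/eqP->//|/IHn].
apply: almost_subS => n /= Hn.
have d i : exists a, tnth Phi i n = Some a /\
    repr (\pi_(cprod A C) (tnth Phi i)) n = Some a.
  by have [a] := Hn _ (mem_tnth i Phi); exists a.
have [t Ht] := choice d.
exists [tuple t i | i < m]; apply/valuesP => i; rewrite tnth_mktuple.
  by case: (Ht i).
by rewrite tnth_map; case: (Ht i).
Qed.

Lemma cprod_relE L (A : nat -> nat_structure L) (hA : uniformly_computable A)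
    C (s : rel_sym L) (Phi : (rel_arity s).-tuple (cfun A C)) :
  rel_interp (cohesive_product hA C) (map_tuple \pi_(cprod A C) Phi) <->
  cfun_rel Phi.
Proof.
rewrite /= /cfun_rel (_ : map_tuple repr _ =
  map_tuple (fun phi => repr (\pi_(cprod A C) phi)) Phi); last first.
  by apply: eq_from_tnth => i; rewrite !tnth_map.
by split=> H; apply: almost_subS (almost_subI H (almost_values_repr Phi))
  => n /= [[t]]; [move=> tE rt [u uE] | move=> tE rt [u + uE]];
  rewrite tE => -[tu]; exists u => //; rewrite -tu.
Qed.

Lemma cprod_funE L (A : nat -> nat_structure L) (hA : uniformly_computable A)
    C (s : fun_sym L) (Phi : (fun_arity s).-tuple (cfun A C)) :
  fun_interp (cohesive_product hA C) (map_tuple \pi_(cprod A C) Phi) =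
  \pi_(cprod A C) (cfun_fun hA Phi).
Proof.
rewrite /= (_ : map_tuple repr _ =
  map_tuple (fun phi => repr (\pi_(cprod A C) phi)) Phi); last first.
  by apply: eq_from_tnth => i; rewrite !tnth_map.
apply/cprod_eqP; apply: almost_subS (almost_values_repr Phi) => n [t tE uE].
by exists (fun_interp (str (A n)) t); rewrite /= ?tE ?uE.
Qed.

(* Main.v *)
Require Import Defs.
From Stdlib Require Cantor.
From mathcomp Require Import all_boot.
From mathcomp Require Import boolp classical_sets functions cardinality.
From mathcomp Require Import zify.

Set Implicit Arguments.
Unset Strict Implicit.
Unset Printing Implicit Defensive.

(** The elements of the cohesive product are classes of partial computable
    functions, and such a function has an index, namely (the number of) a
    program for it. The presentation has as its domain the least indices of the
    classes, and it carries the structure of the product along the bijection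
    that sends a least index to its class. What has to be shown is that the
    diagram of this presentation is [Delta_(k+1)].

    The main part of every clause of the diagram asks, for a parameter [p],
    whether [C] is almost contained in a set [{n | S p n}] where [S] is a
    [Sigma_1] relation:
    that an index converges almost everywhere on [C], that two indices agree
    there, that a relation holds there, or that an index agrees there with the
    value of a function symbol or a constant. As a statement with quantifiers,
    [exists m, forall n >= m, n \in C -> S p n] is [Sigma_(k+1)], because the
    part after [exists m] is [Pi_k] if [C] is [Sigma_k] and [k >= 2]. Since
    [{n | S p n}] is c.e. for each fixed [p], cohesiveness says that if [C] is
    not almost contained in this set then it is almost contained in the
    complement, and that is [Sigma_(k+1)] for the same reason. So the condition
    is [Delta_(k+1)]; this is [Delta_almost_sub]. Being a least index adds a
    bounded quantifier, under which [Delta_(k+1)] is closed.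

    The uniformity in the indices needs a universal partial computable function:
    the relation saying that program number [e] halts on [x] with output [y]
    must be [Sigma_1] in [e], [x] and [y] together ([Sigma_index_eval]). It is
    obtained as the existence of a derivation, a finite list of triples [e, x,
    y] each of which follows by one rule of the semantics from triples later in
    the list; that a given list is a derivation is itself [Sigma_1], by the
    closure properties of [Sigma_1].

    The [Sigma_k] sets with [k > 0] are closed under computable preimages,
    conjunction, disjunction, bounded quantifiers and existential quantifiers,
    so that the complexity of a set is read off from a description of it. In
    such a description several variables are packed into one number by
    pairing. *)

Local Open Scope classical_set_scope.
Local Open Scope quotient_scope.

(** * Pairing *)

Lemma nfst_npair x y : nfst (npair x y) = x.
Proof. by rewrite /nfst /npair Cantor.cancel_of_to. Qed.

Lemma nsnd_npair x y : nsnd (npair x y) = y.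
Proof. by rewrite /nsnd /npair Cantor.cancel_of_to. Qed.

Definition npairE := (nfst_npair, nsnd_npair).

Lemma npair_eta z : npair (nfst z) (nsnd z) = z.
Proof.
by rewrite /npair /nfst /nsnd -surjective_pairing Cantor.cancel_to_of.
Qed.

Lemma npair_inj x y x' y' : npair x y = npair x' y' -> x = x' /\ y = y'.
Proof.
by move=> e; rewrite -(nfst_npair x y) -{2}(nsnd_npair x y) e !npairE.
Qed.

Lemma leq_npair x y : x + y <= npair x y.
Proof. have := Cantor.to_nat_non_decreasing x y; rewrite /npair; lia. Qed.

(** The strict inequality makes recursion on numbers that are tagged by their
    first component well founded. *)
Lemma ltn_nsnd e : nfst e != 0 -> nsnd e < e.
Proof. by have := leq_npair (nfst e) (nsnd e); rewrite npair_eta; lia. Qed.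

Lemma leq_nfst e : nfst e <= e.
Proof. by have := leq_npair (nfst e) (nsnd e); rewrite npair_eta; lia. Qed.

Lemma leq_nsnd e : nsnd e <= e.
Proof. by have := leq_npair (nfst e) (nsnd e); rewrite npair_eta; lia. Qed.

(** * Total computable functions *)

Lemma prec_eval_fun E G a :
  (forall x y y', E x y -> E x y' -> y = y') ->
  (forall x y y', G x y -> G x y' -> y = y') ->
  forall n y y', prec_eval E G a n y -> prec_eval E G a n y' -> y = y'.
Proof.
move=> Ef Gf; elim=> [|n IH] y y' /=; first exact: Ef.
by move=> [z /IH ez Gy] [z' /ez<- Gy']; exact: Gf Gy Gy'.
Qed.

Lemma eval_fun c x y y' : eval c x y -> eval c x y' -> y = y'.
Proof.
elim: c x y y' => [| | | |c IHc d IHd|c IHc d IHd|c IHc d IHd|c IHc] x y y' /=;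
  try by move=> -> ->.
- move=> [a [b [ca db ->]]] [a' [b' [ca' db' ->]]].
  by rewrite (IHc _ _ _ ca ca') (IHd _ _ _ db db').
- by move=> [a da cy] [a' /(IHd _ _ _ da)<- /(IHc _ _ _ cy)].
- exact: prec_eval_fun.
- move=> [c0 lt0] [c0' lt0']; case: (ltngtP y y') => // [/lt0'|/lt0] [v].
    by move/(IHc _ _ _ c0).
  by move/(IHc _ _ _ c0').
Qed.

Definition computable (f : nat -> nat) :=
  partial_computable (fun n => Some (f n)).

(** As programs are deterministic, it is enough to say what a program does
    return. *)
Lemma computableI c (f : nat -> nat) : (forall x, eval c x (f x)) ->
  computable f.
Proof.
move=> cf; exists c => x y; split=> [cy|[<-]]; last exact: cf.
by rewrite (eval_fun (cf x) cy).
Qed.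

Lemma computable_code f : computable f -> exists c, forall x, eval c x (f x).
Proof. by move=> [c cf]; exists c => x; apply/cf. Qed.

Lemma comp_id : computable (fun x => x).
Proof. exact: pc_id. Qed.

Lemma comp_const k : computable (fun=> k).
Proof. exact: pc_const. Qed.

Lemma comp_comp g f : computable g -> computable f ->
  computable (fun x => g (f x)).
Proof. by move=> cg cf; exact: (pc_comp cf cg). Qed.

Lemma comp_S f : computable f -> computable (fun x => (f x).+1).
Proof. by apply: (@comp_comp S); exists CSucc => x y /=; split=> [->|[]]. Qed.

Lemma comp_nfst f : computable f -> computable (fun x => nfst (f x)).
Proof. by apply: (@comp_comp nfst); exists CFst => x y /=; split=> [->|[]]. Qed.

Lemma comp_nsnd f : computable f -> computable (fun x => nsnd (f x)).
Proof. by apply: (@comp_comp nsnd); exists CSnd => x y /=; split=> [->|[]]. Qed.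

Lemma comp_npair f g : computable f -> computable g ->
  computable (fun x => npair (f x) (g x)).
Proof. by move=> cf cg; exact: (pc_pair cf cg). Qed.

Create HintDb comp.
#[local] Hint Resolve comp_id comp_const comp_S comp_nfst comp_nsnd comp_npair
  : comp.

(** Primitive recursion with a parameter [x]; the step is a program of three
    arguments, the parameter, the stage and the previous value. *)
Lemma comp_iteri (g : nat -> nat -> nat -> nat) f b :
  computable (fun z => g (nfst z) (nfst (nsnd z)) (nsnd (nsnd z))) ->
  computable f -> computable b -> computable (fun x => iteri (f x) (g x) (b x)).
Proof.
move=> /computable_code[cg Hg] cf /computable_code[cb Hb].
have rec : computable (fun z => iteri (nsnd z) (g (nfst z)) (b (nfst z))).
  apply: (@computableI (CPrec cb cg)) => z /=; elim: (nsnd z) => [|n IH] /=;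
    first exact: Hb.
  exists (iteri n (g (nfst z)) (b (nfst z))) => //.
  by have := Hg (npair (nfst z) (npair n (iteri n (g (nfst z)) (b (nfst z)))));
     rewrite !npairE.
have := comp_comp rec (comp_npair comp_id cf); congr computable.
by apply/funext => x; rewrite !npairE.
Qed.

Lemma iteri_iter n (g : nat -> nat) b : iteri n (fun=> g) b = iter n g b.
Proof. by elim: n => //= n ->. Qed.

Lemma comp_iter (g : nat -> nat -> nat) f b :
  computable (fun z => g (nfst z) (nsnd z)) ->
  computable f -> computable b -> computable (fun x => iter (f x) (g x) (b x)).
Proof.
move=> cg cf cb.
rewrite (_ : (fun _ => _) = fun x => iteri (f x) (fun=> g x) (b x)); last first.
  by apply/funext => x; rewrite iteri_iter.
apply: (@comp_iteri (fun x _ z => g x z)) => //.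
have /(comp_comp cg) : computable (fun z => npair (nfst z) (nsnd (nsnd z))).
  by auto with comp.
by congr computable; apply/funext => x; rewrite !npairE.
Qed.

Lemma comp_pred f : computable f -> computable (fun x => (f x).-1).
Proof.
apply: (@comp_comp predn).
have : computable (fun x => iteri x (fun i _ => i) 0).
  by apply: (@comp_iteri (fun _ i _ => i)); auto with comp.
by congr computable; apply/funext => -[].
Qed.
#[local] Hint Resolve comp_pred : comp.

Lemma comp_sub f g : computable f -> computable g ->
  computable (fun x => f x - g x).
Proof.
move=> cf cg.
have : computable (fun x => iter (g x) predn (f x)).
  by apply: (@comp_iter (fun=> predn)) => //; auto with comp.
congr computable; apply/funext => x; elim: (g x) => [|n IH] /=;
  first by rewrite subn0.
by rewrite IH subnS.
Qed.
#[local] Hint Resolve comp_sub : comp.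

Lemma comp_if (p : nat -> bool) f g :
  computable (fun x => p x) -> computable f -> computable g ->
  computable (fun x => if p x then f x else g x).
Proof.
move=> cp cf cg.
have : computable (fun x => iter (p x) (fun=> f x) (g x)).
  apply: (@comp_iter (fun x _ => f x)) => //.
  by apply: (@comp_comp f) => //; auto with comp.
by congr computable; apply/funext => x; case: (p x).
Qed.

Lemma comp_neg (p : nat -> bool) : computable (fun x => p x) ->
  computable (fun x => ~~ p x).
Proof.
move=> cp; have : computable (fun x => 1 - p x) by auto with comp.
by congr computable; apply/funext => x; case: (p x).
Qed.

Lemma comp_and (p q : nat -> bool) :
  computable (fun x => p x) -> computable (fun x => q x) ->
    computable (fun x => p x && q x).
Proof.
move=> cp cq; have := comp_if cp cq (comp_const 0).
by congr computable; apply/funext => x; case: (p x).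
Qed.

Lemma comp_leq f g : computable f -> computable g ->
  computable (fun x => f x <= g x).
Proof.
move=> cf cg; have : computable (fun x => 1 - (f x - g x)) by auto with comp.
by congr computable; apply/funext => x; lia.
Qed.

Lemma comp_eq f g : computable f -> computable g ->
  computable (fun x => f x == g x).
Proof.
move=> cf cg; have := comp_and (comp_leq cf cg) (comp_leq cg cf).
by congr computable; apply/funext => x; rewrite eqn_leq.
Qed.

Lemma comp_all (p : nat -> nat -> bool) f :
  computable (fun z => p (nfst z) (nsnd z)) -> computable f ->
  computable (fun x => all (p x) (iota 0 (f x))).
Proof.
move=> cp cf.
have : computable (fun x => iteri (f x) (fun i z =>
  if z == 0 then 0 else p x i) 1).
  apply: (@comp_iteri (fun x i z => if z == 0 then 0 else p x i)) => //;
    last first.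
    exact: comp_const.
  apply: (@comp_if (fun z => _ == 0)); auto with comp.
    by apply: comp_eq; auto with comp.
  have /(comp_comp cp) : computable (fun z => npair (nfst z) (nfst (nsnd z))).
    by auto with comp.
  by congr computable; apply/funext => x; rewrite !npairE.
congr computable; apply/funext => x; elim: (f x) => // n IH.
by rewrite -[in RHS]addn1 iotaD all_cat /= IH add0n andbT; case: (all _ _).
Qed.

(** * Finite sequences as numbers *)

(** The fuel is an upper bound on the number that is decoded, as each tail is
    smaller than the whole. *)
Fixpoint unseq_fuel (n w : nat) : seq nat :=
  match n, w with
  | n'.+1, w'.+1 => nfst w' :: unseq_fuel n' (nsnd w')
  | _, _ => [::]
  end.

Definition unseq (w : nat) : seq nat := unseq_fuel w w.

Arguments unseq : simpl never.

Lemma unseq_fuelE n w : w <= n -> unseq_fuel n w = unseq w.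
Proof.
rewrite /unseq; elim/ltn_ind: w n => -[|w] IH [|n] //= lewn.
by congr (_ :: _); rewrite !(IH (nsnd w)) //; have := leq_nsnd w; lia.
Qed.

Lemma unseq0 : unseq 0 = [::]. Proof. by []. Qed.

Lemma unseqS w : unseq w.+1 = nfst w :: unseq (nsnd w).
Proof. by rewrite {1}/unseq /= unseq_fuelE ?leq_nsnd. Qed.

Lemma code_seqK : cancel code_seq unseq.
Proof.
elim=> [|x s IH]; first exact: unseq0.
by rewrite -[code_seq _]/(npair x (code_seq s)).+1 unseqS !npairE IH.
Qed.

Lemma unseqK w : code_seq (unseq w) = w.
Proof.
elim/ltn_ind: w => -[|w] IH //; rewrite unseqS /= IH ?npair_eta //.
by have := leq_nsnd w; lia.
Qed.

(** This bound lets the length be computed by a recursion of [w] stages. *)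
Lemma size_unseq w : size (unseq w) <= w.
Proof.
elim/ltn_ind: w => -[|w] IH //; rewrite unseqS /=.
by have := leq_nsnd w; have := IH (nsnd w); lia.
Qed.

Lemma iter_tail i w :
  unseq (iter i (fun z => nsnd z.-1) w) = drop i (unseq w).
Proof.
have tlE z : unseq (nsnd z.-1) = behead (unseq z) by case: z => // z;
  rewrite unseqS.
elim: i w => [|i IH] w; first by rewrite drop0.
by rewrite iterSr IH tlE; case: (unseq w) => //; rewrite /= drop_nil.
Qed.

Lemma comp_nth f g : computable f -> computable g ->
  computable (fun x => nth 0 (unseq (f x)) (g x)).
Proof.
move=> cf cg.
have ct : computable (fun x => iter (g x) (fun z => nsnd z.-1) (f x)).
  by apply: (@comp_iter (fun _ z => nsnd z.-1)) => //; auto with comp.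
have : computable (fun x => nfst (iter (g x) (fun z => nsnd z.-1) (f x)).-1).
  by auto with comp.
congr computable; apply/funext => x.
rewrite -[g x in RHS]addn0 -nth_drop -iter_tail.
by case: (iter _ _ _) => // w; rewrite unseqS.
Qed.

Lemma comp_size f : computable f -> computable (fun x => size (unseq (f x))).
Proof.
apply: (@comp_comp (fun w => size (unseq w))).
pose g w i z := if iter i (fun z => nsnd z.-1) w == 0 then z else z.+1.
have : computable (fun w => iteri w (g w) 0).
  apply: comp_iteri; try by auto with comp.
  apply: (@comp_if (fun z => _ == 0)); auto with comp.
  apply: comp_eq; auto with comp.
  by apply: (@comp_iter (fun _ z => nsnd z.-1)); auto with comp.
congr computable; apply/funext => w.
suff H n : iteri n (g w) 0 = minn n (size (unseq w)).
  by rewrite H; have := size_unseq w; lia.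
elim: n => [|n /= ->] //; first by rewrite min0n.
rewrite /g; have := congr1 size (iter_tail n w); rewrite size_drop.
by case: (iter _ _ _) => [|v]; rewrite ?unseqS /=; lia.
Qed.
#[local] Hint Resolve comp_nth comp_size : comp.

(** * The arithmetical hierarchy *)

Lemma Sigma_ext k (P Q : set nat) :
  (forall x, P x <-> Q x) -> Sigma_set k P -> Sigma_set k Q.
Proof. by move=> /predeqP->. Qed.

Lemma Sigma_preimage k A f : computable f -> Sigma_set k A ->
  Sigma_set k (fun x => A (f x)).
Proof.
move=> cf; elim: k A f cf => [|k IH] A f cf /=; first exact: (fun cA =>
  comp_comp cA cf).
move=> [B sB ->]; exists (fun z => B (npair (f (nfst z)) (nsnd z))).
  by apply: (IH _ (fun z => npair (f (nfst z)) (nsnd z))) sB;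
     apply: comp_npair; [apply: comp_comp cf _|]; auto with comp.
by apply/predeqP => x; split=> -[y H]; exists y; move: H; rewrite !npairE.
Qed.

Lemma Sigma0_bool (p : nat -> bool) : computable (fun x => p x) ->
  Sigma_set 0 (fun x => p x).
Proof.
by congr computable; apply/funext => x; congr nat_of_bool; apply/idP/idP;
   rewrite in_setE.
Qed.

Lemma Sigma0_computable A : Sigma_set 0 A -> computable (fun x => `[< A x >]).
Proof.
by congr computable; apply/funext => x; congr nat_of_bool; apply/idP/idP;
   rewrite in_setE => /asboolP.
Qed.

Lemma Sigma_exPi k (B : set nat) : Sigma_set k (fun z => ~ B z) ->
  Sigma_set k.+1 (fun x => exists y, B (npair x y)).
Proof. by exists B. Qed.

(** Both closures are proved together: the matrix of a [Sigma_(k+1)] set is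
    [Pi_k], and its complement turns one connective into the other. *)
Lemma Sigma_and_or k A B : Sigma_set k A -> Sigma_set k B ->
  Sigma_set k (fun x => A x /\ B x) /\ Sigma_set k (fun x => A x \/ B x).
Proof.
elim: k A B => [|k IH] A B.
  move=> /Sigma0_computable cA /Sigma0_computable cB; split.
    apply: Sigma_ext (Sigma0_bool (comp_and cA cB)) => x.
    by split=> [/andP[/asboolP ? /asboolP]|[? ?]] //; apply/andP; split;
      apply/asboolP.
  apply: Sigma_ext (Sigma0_bool (comp_neg (comp_and (comp_neg cA)
    (comp_neg cB)))) => x.
  by rewrite negb_and !negbK; split=> [/orP[]/asboolP|[] ?]; try tauto;
     apply/orP; [left|right]; apply/asboolP.
move=> [a sa ->] [b sb ->].
pose pre0 (z : nat) := npair (nfst z) (nfst (nsnd z)).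
pose pre1 (z : nat) := npair (nfst z) (nsnd (nsnd z)).
have c0 : computable pre0 by rewrite /pre0; auto with comp.
have c1 : computable pre1 by rewrite /pre1; auto with comp.
have [sA sO] := IH _ _ (Sigma_preimage c0 sa) (Sigma_preimage c1 sb); split.
  apply: Sigma_ext (@Sigma_exPi k (fun z => a (pre0 z) /\ b (pre1 z)) _);
    last first.
    by apply: Sigma_ext sO => x; rewrite -not_andP.
  move=> x; rewrite /pre0 /pre1; split=> [[y]|[[y ay] [z bz]]].
    by rewrite !npairE => -[]; split; [exists (nfst y)|exists (nsnd y)].
  by exists (npair y z); rewrite !npairE.
apply: Sigma_ext (@Sigma_exPi k (fun z => a z \/ b z) _); last first.
  by apply: Sigma_ext (IH _ _ sa sb).1 => x; rewrite not_orP.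
by move=> x; split=> [[y []]|[] [y]];
   [left|right|exists y; left|exists y; right]; try exists y.
Qed.

Lemma Sigma_and k A B : Sigma_set k A -> Sigma_set k B ->
  Sigma_set k (fun x => A x /\ B x).
Proof. by move=> sA sB; case: (Sigma_and_or sA sB). Qed.

Lemma Sigma_or k A B : Sigma_set k A -> Sigma_set k B ->
  Sigma_set k (fun x => A x \/ B x).
Proof. by move=> sA sB; case: (Sigma_and_or sA sB). Qed.

Lemma Pi_Sigma k A : Sigma_set k (fun x => ~ A x) -> Sigma_set k.+1 A.
Proof.
move=> sA; apply: Sigma_ext (@Sigma_exPi k (fun z => A (nfst z)) _).
  by move=> x; split=> [[y]|Ax]; rewrite ?npairE //; exists 0; rewrite npairE.
by apply: (@Sigma_preimage k (fun x => ~ A x)) sA; auto with comp.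
Qed.

Lemma Sigma_S k A : Sigma_set k A -> Sigma_set k.+1 A.
Proof.
elim: k A => [|k IH] A; last by move=> [B sB ->]; exact: Sigma_exPi (IH _ sB).
move=> /Sigma0_computable/comp_neg/Sigma0_bool sA; apply: Pi_Sigma;
  apply: Sigma_ext sA => x.
by split=> [/asboolPn|nA]; last exact/asboolPn.
Qed.

Lemma Sigma_le j k A : j <= k -> Sigma_set j A -> Sigma_set k A.
Proof.
by move=> /subnKC <-; elim: (k - j) => [|i IH] /=; rewrite ?addn0 // addnS =>
  /IH/Sigma_S.
Qed.

Lemma Sigma_bool k (p : nat -> bool) : computable (fun x => p x) ->
  Sigma_set k (fun x => p x).
Proof. by move=> /Sigma0_bool; exact: Sigma_le. Qed.

Lemma Sigma_eq k f g : computable f -> computable g ->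
  Sigma_set k (fun x => f x = g x).
Proof.
move=> cf cg; apply: Sigma_ext (Sigma_bool k (comp_eq cf cg)) => x.
by split=> [/eqP|->].
Qed.

(** Two adjacent existential quantifiers are merged into one over pairs. *)
Lemma Sigma_ex k (P : nat -> nat -> Prop) :
  Sigma_set k.+1 (fun z => P (nfst z) (nsnd z)) ->
  Sigma_set k.+1 (fun x => exists y, P x y).
Proof.
move=> [B sB EB].
pose pre (z : nat) := npair (npair (nfst z) (nfst (nsnd z))) (nsnd (nsnd z)).
apply: Sigma_ext (@Sigma_exPi k (fun z => B (pre z)) _); last first.
  by apply: Sigma_preimage sB; rewrite /pre; auto with comp.
have EP x y : P x y <-> exists w, B (npair (npair x y) w).
  by have := congr1 (fun S => S (npair x y)) EB; rewrite /= !npairE => ->.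
move=> x; rewrite /pre; split=> [[w]|[y /EP[w Bw]]].
  by rewrite !npairE => Bw; exists (nfst w); apply/EP; exists (nsnd w).
by exists (npair y w); rewrite !npairE.
Qed.

(** For [Pi_k] sets with [k > 0] a bounded universal quantifier is absorbed by
    the leading universal one; for [k = 0] it is a bounded search. *)
Lemma Pi_ball k (P : nat -> nat -> Prop) f : computable f ->
  Sigma_set k (fun z => ~ P (nfst z) (nsnd z)) ->
  Sigma_set k (fun x => ~ forall i, i < f x -> P x i).
Proof.
move=> cf; case: k => [|k] sP.
  have cP : computable (fun z => (fun x i => `[< P x i >]) (nfst z) (nsnd z)).
    have := comp_neg (Sigma0_computable sP).
    by congr computable; apply/funext => z; congr nat_of_bool;
      rewrite asbool_neg negbK.
  apply: Sigma_ext (Sigma0_bool (comp_neg (comp_all cP cf))) => x.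
  have allE : (forall i, i < f x -> P x i) <->
      all (fun i => `[< P x i >]) (iota 0 (f x)).
    split=> [H|/allP H i lti].
      by apply/allP => i; rewrite mem_iota => /andP[_ lti]; apply/asboolP/H.
    by apply/asboolP/H; rewrite mem_iota.
  by split=> [/negP nH /allE|nH]; [exact: nH|apply/negP => /allE].
apply: Sigma_ext (@Sigma_ex k (fun x i => i < f x /\ ~ P x i) _); last first.
  apply: Sigma_and => //; apply: (@Sigma_bool _ (fun z => nsnd z < f (nfst z))).
  apply: comp_leq; first by auto with comp.
  by apply: (comp_comp cf); auto with comp.
move=> x; split=> [[i [lti nP]] /(_ i lti)//|].
by move=> /existsNP[i /not_implyP[lti nP]]; exists i.
Qed.

(** The bounded quantifier moves inside the unbounded existential one, which
    then ranges over the sequence of all the witnesses. *)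
Lemma Sigma_ball k (P : nat -> nat -> Prop) f : computable f ->
  Sigma_set k.+1 (fun z => P (nfst z) (nsnd z)) ->
  Sigma_set k.+1 (fun x => forall i, i < f x -> P x i).
Proof.
move=> cf [B sB EB].
have EP x y : P x y <-> exists w, B (npair (npair x y) w).
  by have := congr1 (fun S => S (npair x y)) EB; rewrite /= !npairE => ->.
pose Q z i := B (npair (npair (nfst z) i) (nth 0 (unseq (nsnd z)) i)).
apply: Sigma_ext (@Sigma_exPi k (fun z => forall i, i < f (nfst z) -> Q z i) _);
    last first.
  apply: Pi_ball; first by apply: comp_comp cf _; auto with comp.
  apply: (@Sigma_preimage _ _ (fun z => npair (npair (nfst (nfst z)) (nsnd z))
    (nth 0 (unseq (nsnd (nfst z))) (nsnd z)))) sB; auto with comp.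
move=> x; rewrite /Q; split=> [[w H] i lti|H].
  by apply/EP; have := H i; rewrite !npairE => /(_ lti);
    exists (nth 0 (unseq w) i).
have [|g Hg] := @choice _ _ (fun i w => i < f x -> B (npair (npair x i) w)).
  by move=> i; case: (ltnP i (f x)) => [/H/EP[w]|]; [exists w|exists 0].
exists (code_seq (mkseq g (f x))) => i; rewrite !npairE code_seqK => lti.
by rewrite nth_mkseq //; exact: Hg.
Qed.

Lemma Delta_ext k (P Q : set nat) :
  (forall x, P x <-> Q x) -> Delta_set k P -> Delta_set k Q.
Proof. by move=> /predeqP->. Qed.

Lemma Delta_preimage k A f : computable f -> Delta_set k A ->
  Delta_set k (fun x => A (f x)).
Proof.
by move=> cf [sA pA]; split;
  [exact: Sigma_preimage|exact: (Sigma_preimage cf pA)].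
Qed.

Lemma Delta_and k A B : Delta_set k A -> Delta_set k B ->
  Delta_set k (fun x => A x /\ B x).
Proof.
move=> [sA pA] [sB pB]; split; first exact: Sigma_and.
by apply: Sigma_ext (Sigma_or pA pB) => x; rewrite -not_andP.
Qed.

Lemma Delta_not k A : Delta_set k A -> Delta_set k (fun x => ~ A x).
Proof.
by move=> [sA pA]; split=> //; apply: Sigma_ext sA => x; split=> [?|/contrapT].
Qed.

Lemma Delta_or k A B : Delta_set k A -> Delta_set k B ->
  Delta_set k (fun x => A x \/ B x).
Proof.
move=> [sA pA] [sB pB]; split; first exact: Sigma_or.
by apply: Sigma_ext (Sigma_and pA pB) => x; rewrite -not_orP.
Qed.

Lemma Delta_ball k (P : nat -> nat -> Prop) f : computable f ->
  Delta_set k.+1 (fun z => P (nfst z) (nsnd z)) ->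
  Delta_set k.+1 (fun x => forall i, i < f x -> P x i).
Proof.
by move=> cf [sP pP]; split; [exact: Sigma_ball|exact: (Pi_ball cf pP)].
Qed.

Lemma Sigma_Delta j k A : j < k -> Sigma_set j A -> Delta_set k A.
Proof.
move=> ltjk sA; split; first by apply: Sigma_le sA; exact: ltnW.
apply: (Sigma_le ltjk); apply: Pi_Sigma; apply: Sigma_ext sA => x.
by split=> [?|/contrapT].
Qed.

(** * The universal relation *)

(** A number is read as a tag followed by a pair of numbers of subprograms.
    Every number is the number of a program, so that no condition of being an
    index ever has to be decided. *)
Fixpoint decode_fuel (n e : nat) : code :=
  match n with
  | 0 => CZero
  | n'.+1 =>
    let l := decode_fuel n' (nfst (nsnd e)) in
    let r := decode_fuel n' (nsnd (nsnd e)) in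
    match nfst e with
    | 0 => CZero
    | 1 => CSucc
    | 2 => CFst
    | 3 => CSnd
    | 4 => CPair l r
    | 5 => CComp l r
    | 6 => CPrec l r
    | _ => CMu l
    end
  end.

Definition decode (e : nat) : code := decode_fuel e.+1 e.

Lemma decode_fuelE n m e : e < n -> e < m -> decode_fuel n e = decode_fuel m e.
Proof.
elim: n m e => [|n IH] [|m] e //= ltn ltm.
case E: (nfst e) => [|t] //; have lte : nsnd e < e by apply: ltn_nsnd;
  rewrite E.
have := leq_nfst (nsnd e); have := leq_nsnd (nsnd e) => le1 le2.
by rewrite !(IH m) //; lia.
Qed.

Lemma decodeE e :
  let l := decode (nfst (nsnd e)) in
  let r := decode (nsnd (nsnd e)) in
  decode e = match nfst e with
    | 0 => CZero
    | 1 => CSucc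
    | 2 => CFst
    | 3 => CSnd
    | 4 => CPair l r
    | 5 => CComp l r
    | 6 => CPrec l r
    | _ => CMu l
    end.
Proof.
rewrite /= {1}/decode /=.
case E: (nfst e) => [|t] //; have lte : nsnd e < e by apply: ltn_nsnd;
  rewrite E.
have := leq_nfst (nsnd e); have := leq_nsnd (nsnd e) => le1 le2.
rewrite (@decode_fuelE e (nfst (nsnd e)).+1 (nfst (nsnd e))) ?ltnS //;
  last by lia.
by rewrite (@decode_fuelE e (nsnd (nsnd e)).+1 (nsnd (nsnd e))) ?ltnS //; lia.
Qed.

Lemma decode_surj c : exists e, decode e = c.
Proof.
elim: c => [| | | |c [e1 E1] d [e2 E2]|c [e1 E1] d [e2 E2]|
  c [e1 E1] d [e2 E2]|c [e1 E1]].
- by exists (npair 0 0); rewrite decodeE npairE.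
- by exists (npair 1 0); rewrite decodeE npairE.
- by exists (npair 2 0); rewrite decodeE npairE.
- by exists (npair 3 0); rewrite decodeE npairE.
- by exists (npair 4 (npair e1 e2)); rewrite decodeE !npairE E1 E2.
- by exists (npair 5 (npair e1 e2)); rewrite decodeE !npairE E1 E2.
- by exists (npair 6 (npair e1 e2)); rewrite decodeE !npairE E1 E2.
- by exists (npair 7 (npair e1 0)); rewrite decodeE !npairE E1.
Qed.

Definition index_eval (e x y : nat) : Prop := eval (decode e) x y.

(** One unfolding of [eval (decode e) x y] in which the recursive calls, to
    subprograms and, for primitive recursion, to [e] itself, are answered by
    [M]. With a finite list as [M], this is the rule that justifies one line of
    a derivation. *)
Definition eval_step (M : nat -> nat -> nat -> Prop) (e x y : nat) : Prop :=
  let l := nfst (nsnd e) in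
  let r := nsnd (nsnd e) in
  match nfst e with
  | 0 => y = 0
  | 1 => y = x.+1
  | 2 => y = nfst x
  | 3 => y = nsnd x
  | 4 => exists a b, [/\ M l x a, M r x b & y = npair a b]
  | 5 => exists2 a, M r x a & M l a y
  | 6 => (nsnd x = 0 /\ M l (nfst x) y) \/
         exists n z, [/\ nsnd x = n.+1, M e (npair (nfst x) n) z &
                         M r (npair (nfst x) (npair n z)) y]
  | _ => M l (npair x y) 0 /\ forall z, z < y -> exists v, M l (npair x z) v.+1
  end.

Lemma index_eval_step e x y : index_eval e x y <-> eval_step index_eval e x y.
Proof.
rewrite /eval_step /index_eval; case E: (nfst e) (decodeE e) =>
  [|[|[|[|[|[|[|t]]]]]]] /= decEe; rewrite decEe //=.
case: (nsnd x) => [|n] /=; first by split=> [?|[[//]|[n [z []]]]//]; left.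
split=> [[z pz gz]|[[]//|[n' [z [[<-]]]]]].
  by right; exists n, z; rewrite /= !npairE.
by rewrite /= !npairE; exists z.
Qed.

Definition triple (e x y : nat) : nat := npair e (npair x y).

Definition in_seq (s : seq nat) (e x y : nat) : Prop := triple e x y \in s.

(** A derivation is read from its end: each triple is justified by those that
    come after it. *)
Fixpoint derivation (s : seq nat) : Prop :=
  match s with
  | [::] => True
  | t :: s' => eval_step (in_seq s') (nfst t) (nfst (nsnd t)) (nsnd (nsnd t)) /\
               derivation s'
  end.

Definition derivable (e x y : nat) : Prop :=
  exists2 s, derivation s & in_seq s e x y.

Lemma eval_step_mono (M M' : nat -> nat -> nat -> Prop) e x y :
  (forall e x y, M e x y -> M' e x y) -> eval_step M e x y ->
    eval_step M' e x y.
Proof.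
move=> MM'; rewrite /eval_step; case: (nfst e) => [|[|[|[|[|[|[|t]]]]]]] //.
- by move=> [a [b [/MM' ? /MM' ? ->]]]; exists a, b.
- by move=> [a /MM' ? /MM' ?]; exists a.
- move=> [[-> /MM' ?]|[n [z [? /MM' ? /MM' ?]]]]; first by left.
  by right; exists n, z.
- by move=> [/MM' ? H]; split=> // z /H[v /MM']; exists v.
Qed.

Lemma derivable_index_eval e x y : derivable e x y -> index_eval e x y.
Proof.
move=> [s + Hs]; elim: s e x y Hs => // t s IH e x y.
rewrite /in_seq inE => /orP[/eqP <-|ts] [st ds]; last exact: IH.
rewrite /triple !npairE in st; apply/index_eval_step; apply: eval_step_mono st.
by move=> e' x' y' /IH; exact.
Qed.

Lemma derivation_cat s1 s2 : derivation s1 -> derivation s2 ->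
  derivation (s1 ++ s2).
Proof.
elim: s1 => //= t s IH [st ds] ds2; split; last exact: IH.
by apply: eval_step_mono st => e x y; rewrite /in_seq mem_cat => ->.
Qed.

Lemma in_seq_catl s1 s2 e x y : in_seq s1 e x y -> in_seq (s1 ++ s2) e x y.
Proof. by rewrite /in_seq mem_cat => ->. Qed.

Lemma in_seq_catr s1 s2 e x y : in_seq s2 e x y -> in_seq (s1 ++ s2) e x y.
Proof. by rewrite /in_seq mem_cat => ->; rewrite orbT. Qed.

(** One step makes finitely many calls, also for minimization, where the
    calls are bounded by the output; the derivations of the answers can
    therefore be concatenated. *)
Lemma eval_step_finitary e x y :
  eval_step derivable e x y ->
  exists2 s, derivation s & eval_step (in_seq s) e x y.
Proof.
rewrite /eval_step; case: (nfst e) => [|[|[|[|[|[|[|t]]]]]]] H;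
  try by exists [::].
- move: H => [a [b [[s1 d1 i1] [s2 d2 i2] ->]]].
  exists (s1 ++ s2); first exact: derivation_cat.
  by exists a, b; split=> //; [apply: in_seq_catl|apply: in_seq_catr].
- move: H => [a [s1 d1 i1] [s2 d2 i2]].
  exists (s1 ++ s2); first exact: derivation_cat.
  by exists a; [apply: in_seq_catl|apply: in_seq_catr].
- move: H => [[x0 [s d i]]|[n [z [xn [s1 d1 i1] [s2 d2 i2]]]]].
    by exists s => //; left.
  exists (s1 ++ s2); first exact: derivation_cat.
  by right; exists n, z; split=> //; [apply: in_seq_catl|apply: in_seq_catr].
- move: H => [[s d i] H].
  suff [s' d' H'] : exists2 s', derivation s' & forall z, z < y ->
      exists v, in_seq s' (nfst (nsnd e)) (npair x z) v.+1.
    exists (s ++ s'); first exact: derivation_cat.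
    split; first exact: in_seq_catl.
    by move=> z /H'[v iv]; exists v; exact: in_seq_catr.
  elim: y {i} H => [|y IH] H; first by exists [::].
  have [z ltz|s1 d1 H1] := IH; first by apply: H; exact: ltnW.
  have [v [s2 d2 i2]] := H y (ltnSn y).
  exists (s1 ++ s2) => [|z]; first exact: derivation_cat.
  rewrite ltnS leq_eqVlt => /orP[/eqP->|/H1[w iw]].
    by exists v; exact: in_seq_catr.
  by exists w; exact: in_seq_catl.
Qed.

Lemma eval_step_derivable e x y : eval_step derivable e x y -> derivable e x y.
Proof.
move=> /eval_step_finitary[s ds st]; exists (triple e x y :: s).
  by split=> //; rewrite /triple !npairE.
by rewrite /in_seq inE eqxx.
Qed.

(** By induction on the program, since every call of a step goes to a
    subprogram. Primitive recursion also calls itself, whence the inner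
    induction on the recursion argument. *)
Lemma index_eval_derivable e x y : index_eval e x y -> derivable e x y.
Proof.
rewrite /index_eval; move Ec: (decode e) => c; elim: c e x y Ec;
  [move=> e x y|move=> e x y|move=> e x y|move=> e x y|
   move=> c IHc d IHd e x y|move=> c IHc d IHd e x y|
   move=> c IHc d IHd e x y|move=> c IHc e x y] => Ec evc;
  move: (Ec); rewrite decodeE;
  case E: (nfst e) => [|[|[|[|[|[|[|t]]]]]]] //; (try case) => El;
  (try move=> Er); try by apply: eval_step_derivable; rewrite /eval_step E.
- move: evc => /= [a [b [ca db yab]]]; apply: eval_step_derivable;
    rewrite /eval_step E.
  by exists a, b; split; [apply: IHc|apply: IHd|].
- move: evc => /= [a da cy]; apply: eval_step_derivable; rewrite /eval_step E.
  by exists a; [apply: IHd|apply: IHc].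
- move: evc => /=; rewrite -[x in derivable _ x _]npair_eta; move: (nfst x) =>
    a.
  elim: (nsnd x) y => [|n IHn] y /=.
    move=> cy; apply: eval_step_derivable; rewrite /eval_step E; left.
    by rewrite !npairE; split=> //; apply: IHc.
  move=> [z /IHn dz gz]; apply: eval_step_derivable; rewrite /eval_step E;
    right.
  by exists n, z; rewrite !npairE; split=> //; apply: IHd.
- move: evc => /= [c0 H]; apply: eval_step_derivable; rewrite /eval_step E;
    split.
    exact: IHc.
  by move=> z /H[v cv]; exists v; apply: IHc.
Qed.

Lemma Sigma_if k (p : nat -> bool) (P Q : set nat) :
  computable (fun z => p z) ->
  Sigma_set k P -> Sigma_set k Q ->
  Sigma_set k (fun z => if p z then P z else Q z).
Proof.
move=> cp sP sQ; have /(Sigma_bool k) sn := comp_neg cp; have sp :=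
  Sigma_bool k cp.
apply: Sigma_ext (Sigma_or (Sigma_and sp sP) (Sigma_and sn sQ)) => z.
by case: (p z); split=> [[[]|[]]|] //; [left|right].
Qed.

(** The closure hypothesis on [M] is stated for arbitrary computable arguments,
    because the step calls [M] on terms that contain the variables it
    quantifies. *)
Lemma Sigma_eval_step k (M : nat -> nat -> nat -> nat -> Prop) :
  (forall p e x y,
     computable p -> computable e -> computable x -> computable y ->
     Sigma_set k.+1 (fun z => M (p z) (e z) (x z) (y z))) ->
  forall p e x y,
     computable p -> computable e -> computable x -> computable y ->
     Sigma_set k.+1 (fun z => eval_step (M (p z)) (e z) (x z) (y z)).
Proof.
move=> sM p e x y cp ce cx cy.
have cpre f : computable f -> computable (fun z => f (nfst z)).
  by move=> cf; apply: comp_comp cf _; auto with comp.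
have [cp1 ce1 cx1 cy1] : [/\ computable (fun z => p (nfst z)),
  computable (fun z => e (nfst z)), computable (fun z => x (nfst z)) &
  computable (fun z => y (nfst z))] by split; exact: cpre.
have [cp2 ce2 cx2 cy2] : [/\ computable (fun z => p (nfst (nfst z))),
  computable (fun z => e (nfst (nfst z))),
  computable (fun z => x (nfst (nfst z))) &
  computable (fun z => y (nfst (nfst z)))].
  by split; apply: (cpre (fun z => _ (nfst z))).
apply: (@Sigma_ext _ (fun z =>
  let M := M (p z) in let e := e z in let x := x z in let y := y z in
  let l := nfst (nsnd e) in let r := nsnd (nsnd e) in
  if nfst e == 0 then y = 0
  else if nfst e == 1 then y = x.+1
  else if nfst e == 2 then y = nfst x
  else if nfst e == 3 then y = nsnd x
  else if nfst e == 4 then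
    exists a b, (M l x a /\ M r x b) /\ y = npair a b
  else if nfst e == 5 then exists a, M r x a /\ M l a y
  else if nfst e == 6 then (nsnd x = 0 /\ M l (nfst x) y) \/
    exists n z, (nsnd x = n.+1 /\ M e (npair (nfst x) n) z) /\
                M r (npair (nfst x) (npair n z)) y
  else M l (npair x y) 0 /\
    forall z, z < y -> exists v, M l (npair x z) v.+1)).
  move=> z; rewrite /eval_step; case: (nfst (e z)) =>
    [|[|[|[|[|[|[|t]]]]]]] //=.
  - by split=> -[a [b]] => [[[? ?] ?]|[? ? ?]]; exists a, b.
  - by split=> [[a []]|[a]]; exists a.
  - split=> -[?|[n [w]]]; try by left.
      by move=> [[? ?] ?]; right; exists n, w.
    by move=> [? ? ?]; right; exists n, w.
have ceq i : computable (fun z => nfst (e z) == i) by apply: comp_eq;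
  auto with comp.
repeat (apply: Sigma_if => //); try by apply: Sigma_eq; auto with comp.
- apply: Sigma_ex; apply: Sigma_ex; apply: Sigma_and; last by apply: Sigma_eq;
    auto with comp.
  by apply: Sigma_and; apply: sM; auto with comp.
- by apply: Sigma_ex; apply: Sigma_and; apply: sM; auto with comp.
- apply: Sigma_or; first by apply: Sigma_and; [apply: Sigma_eq|apply: sM];
    auto with comp.
  apply: Sigma_ex; apply: Sigma_ex; apply: Sigma_and; last by apply: sM;
    auto with comp.
  by apply: Sigma_and; [apply: Sigma_eq|apply: sM]; auto with comp.
- apply: Sigma_and; first by apply: sM; auto with comp.
  by apply: Sigma_ball => //; apply: Sigma_ex; apply: sM; auto with comp.
Qed.

(** The recursive definition of derivations is rephrased with a bounded
    quantifier over positions, so that the closure properties apply. *)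
Lemma derivationP s : derivation s <-> forall i, i < size s ->
  eval_step (fun e x y => exists j, i < j < size s /\
                                       nth 0 s j = triple e x y)
    (nfst (nth 0 s i)) (nfst (nsnd (nth 0 s i))) (nsnd (nsnd (nth 0 s i))).
Proof.
elim: s => [|t s IH] /=; first by split.
split=> [[st /IH ds] [_|i lti]|H].
- apply: eval_step_mono st => e x y /(nthP 0)[j ltj E].
  by exists j.+1.
- apply: eval_step_mono (ds i lti) => e x y [j [ltj E]].
  by exists j.+1.
- split.
    apply: eval_step_mono (H 0 isT) => e x y [[|j] [ltj E]] //.
    by apply/(nthP 0); exists j => //=; case/andP: ltj.
  apply/IH => i lti; apply: eval_step_mono (H i.+1 lti) =>
    e x y [[|j] [ltj E]] //.
  by exists j.
Qed.

(** The universal relation is [Sigma_1]: a computation exists iff a derivation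
    of its result does. *)
Lemma Sigma_index_eval e x y : computable e -> computable x -> computable y ->
  Sigma_set 1 (fun z => index_eval (e z) (x z) (y z)).
Proof.
move=> ce cx cy.
suff : Sigma_set 1 (fun z => index_eval (nfst z) (nfst (nsnd z))
  (nsnd (nsnd z))).
  have ct : computable (fun z => triple (e z) (x z) (y z)).
    by rewrite /triple; auto with comp.
  by move=> /(Sigma_preimage ct); apply: Sigma_ext => z;
    rewrite /triple !npairE.
(* The parameter [p] packs a position and a list: the triples available at
   that position are the ones further on in the list. *)
pose M p e x y := exists j, nfst p < j < size (unseq (nsnd p)) /\
   nth 0 (unseq (nsnd p)) j = triple e x y.
apply: (@Sigma_ext _ (fun z => exists w,
    (forall i, i < size (unseq w) -> eval_step (M (npair i w))
      (nfst (nth 0 (unseq w) i)) (nfst (nsnd (nth 0 (unseq w) i)))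
      (nsnd (nsnd (nth 0 (unseq w) i)))) /\
    exists j, j < size (unseq w) /\ nth 0 (unseq w) j = z)).
  move=> z; have : triple (nfst z) (nfst (nsnd z)) (nsnd (nsnd z)) = z.
    by rewrite /triple !npair_eta.
  move: (nfst z) (nfst (nsnd z)) (nsnd (nsnd z)) => {ce cx cy} {}e {}x {}y <-.
  split.
    move=> [w [dw [j [ltj E]]]]; apply: derivable_index_eval; exists (unseq w).
      apply/derivationP => i /dw; apply: eval_step_mono => e' x' y' [k].
      by rewrite !npairE; exists k.
    by apply/(nthP 0); exists j.
  move=> /index_eval_derivable[s /derivationP ds /(nthP 0)[j ltj E]].
  exists (code_seq s); rewrite code_seqK; split; last by exists j.
  move=> i /ds; apply: eval_step_mono => e' x' y' [k ltk].
  by exists k; rewrite !npairE code_seqK.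
apply: Sigma_ex; apply: Sigma_and.
  apply: (@Sigma_ball _ (fun z i => eval_step (M (npair i (nsnd z))) _ _ _));
    auto with comp.
  apply: (@Sigma_eval_step _ M); auto 20 with comp.
  move=> {ce cx cy} p {}e {}x {}y cp ce cx cy; rewrite /M.
  apply: Sigma_ex; apply: Sigma_and; last first.
    by rewrite /triple; apply: Sigma_eq; auto 10 using comp_comp with comp.
  apply: (@Sigma_bool _ (fun z =>
    nfst (p (nfst z)) < nsnd z < size (unseq (nsnd (p (nfst z)))))).
  have cp1 : computable (fun z => p (nfst z)) by apply: comp_comp cp _;
    auto with comp.
  by apply: comp_and; apply: comp_leq; auto with comp.
apply: Sigma_ex; apply: Sigma_and; last by apply: Sigma_eq; auto with comp.
apply: (@Sigma_bool _ (fun z => nsnd z < size (unseq (nsnd (nfst z))))).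
by apply: comp_leq; auto with comp.
Qed.

(** * Computably enumerable sets and cohesiveness *)

Lemma Sigma_graph f g h : partial_computable f -> computable g ->
  computable h ->
  Sigma_set 1 (fun z => f (g z) = Some (h z)).
Proof.
move=> [c cf] cg ch; have [e Ee] := decode_surj c.
apply: Sigma_ext (Sigma_index_eval (comp_const e) cg ch) => z.
by rewrite /index_eval Ee cf.
Qed.

(** To compute [f x], search for a pair of a value and a witness that it is
    the right one; any value found is [f x], the graph being single valued. *)
Lemma Sigma1_partial_computable f :
  Sigma_set 1 (fun z => f (nfst z) = Some (nsnd z)) -> partial_computable f.
Proof.
move=> [B sB EB].
have fP x y : f x = Some y <-> exists w, B (npair (npair x y) w).
  by have := congr1 (fun S => S (npair x y)) EB; rewrite /= !npairE => ->.
pose pre v := npair (npair (nfst v) (nfst (nsnd v))) (nsnd (nsnd v)).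
have cpre : computable pre by rewrite /pre; auto with comp.
have [c Hc] := computable_code (Sigma0_computable (@Sigma_preimage 0 _ _ cpre
  sB)).
have cB x w : eval c (npair x w) 0 <-> B (pre (npair x w)).
  split=> [c0|Bxw].
    have := eval_fun (Hc _) c0; rewrite /setC /=.
    by case: asboolP => // /contrapT.
  by have := Hc (npair x w); case: asboolP => [|_]; first by case.
have cnB x w : ~ B (pre (npair x w)) -> eval c (npair x w) 1.
  by move=> nB; have := Hc (npair x w); case: asboolP.
exists (CComp CFst (CMu c)) => x y /=; split.
  move=> [w [/cB Bw _] ->]; apply/fP; exists (nsnd w).
  by move: Bw; rewrite /pre !npairE.
move=> fx; have ex : exists w, `[< B (pre (npair x w)) >].
  have [w Bw] := (fP _ _).1 fx; exists (npair y w); apply/asboolP.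
  by rewrite /pre !npairE.
case: (ex_minnP ex) => w /asboolP Bw minw; exists w.
  split; first exact/cB.
  move=> z ltz; exists 0; apply: cnB => Bz.
  by have := minw z (asboolT Bz); rewrite leqNgt ltz.
suff : f x = Some (nfst w) by rewrite fx => -[].
by apply/fP; exists (nsnd w); move: Bw; rewrite /pre !npairE.
Qed.

Lemma Sigma1_ce A : Sigma_set 1 A -> ce_set A.
Proof.
move=> sA; exists (fun x => if `[< A x >] then Some 0 else None); last first.
  by apply/predeqP => x /=; case: asboolP.
apply: Sigma1_partial_computable.
have s0 : Sigma_set 1 (fun z => nsnd z = 0) by apply: Sigma_eq; auto with comp.
have sA' : Sigma_set 1 (fun z => A (nfst z)) by apply: Sigma_preimage sA;
  auto with comp.
apply: Sigma_ext (Sigma_and sA' s0) => z.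
case: asboolP => a; split; [by case=> _ ->|by case=> <-|by case|by []].
Qed.

(** On the natural numbers finite means bounded, which gives the inclusion up to
    finitely many elements an arithmetical form. *)
Lemma almost_subP C Y :
  almost_sub C Y <-> exists m, forall n, m <= n -> C n -> Y n.
Proof.
split=> [/finite_seqP[s Es]|[m Hm]].
  exists (sumn s).+1 => n ltn Cn; apply: contrapT => nY.
  have : n \in s by have : (C `\` Y) n by []; rewrite Es.
  suff H : n \in s -> n <= sumn s by move=> /H; lia.
  elim: (s) => //= a s' IH; rewrite inE => /orP[/eqP->|/IH]; lia.
apply: (sub_finite_set _ (finite_II m)) => n [Cn nY] /=.
by rewrite ltnNge; apply/negP => /Hm/(_ Cn).
Qed.

Lemma almost_sub_ex C Y : infinite_set C -> almost_sub C Y -> exists n, Y n.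
Proof.
move=> infC CY; apply: contrapT => nY; apply: infC.
apply: sub_finite_set CY => n Cn; split=> // Yn; apply: nY; by exists n.
Qed.

(** The condition is [exists m, forall n >= m, n \in C -> T p n]. If [C] and the
    complement of [T] are [Sigma_(k+1)], then what follows [exists m] is
    [Pi_(k+1)]. *)
Lemma Sigma_eventually k C (T : nat -> nat -> Prop) : Sigma_set k.+1 C ->
  Sigma_set k.+1 (fun z => ~ T (nfst z) (nsnd z)) ->
  Sigma_set k.+2 (fun p => almost_sub C [set n | T p n]).
Proof.
move=> sC sT.
apply: (@Sigma_ext _ (fun p => exists m, ~ exists n, m <= n /\ C n /\ ~ T p n)).
  move=> p; rewrite almost_subP; split=> -[m H]; exists m.
    by move=> n ltmn Cn; apply: contrapT => nT; apply: H; exists n.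
  by move=> [n [ltmn [Cn nT]]]; exact/nT/H.
apply: Sigma_ex; apply: Pi_Sigma.
apply: (@Sigma_ext _ (fun z => exists n, nsnd z <= n /\ C n /\ ~ T (nfst z) n)).
  by move=> z; split=> [?|/contrapT].
apply: Sigma_ex; apply: Sigma_and.
  apply: (@Sigma_bool _ (fun z => nsnd (nfst z) <= nsnd z)).
  by apply: comp_leq; auto with comp.
apply: Sigma_and; first by apply: Sigma_preimage sC; auto with comp.
have cp : computable (fun z => npair (nfst (nfst z)) (nsnd z))
  by auto with comp.
by apply: Sigma_ext (Sigma_preimage cp sT) => z; rewrite !npairE.
Qed.

(** Cohesiveness makes the negation as simple as the condition itself: as
    [{n | S p n}] is c.e., [C] is not almost contained in it iff [C] is almost
    contained in its complement. *)
Lemma Delta_almost_sub k C (S : nat -> nat -> Prop) : 1 < k ->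
  cohesive C -> Sigma_set k C ->
  Sigma_set 1 (fun z => S (nfst z) (nsnd z)) ->
  Delta_set k.+1 (fun p => almost_sub C [set n | S p n]).
Proof.
case: k => // k ltk [infC cohC] sC sS; split.
  by apply: Sigma_eventually => //; have [] := Sigma_Delta ltk sS.
apply: (@Sigma_ext _ (fun p => almost_sub C [set n | ~ S p n])); last first.
  apply: Sigma_eventually => //; apply: (@Sigma_ext _ (fun z =>
    S (nfst z) (nsnd z))).
    by move=> z; split=> [?|/contrapT].
  by apply: Sigma_le sS; apply: ltnW.
move=> p; split=> [nS pS|nS].
  by have [n []] := almost_sub_ex infC (almost_subI nS pS).
have : Sigma_set 1 (fun n => S p n).
  have cp : computable (fun n => npair p n) by auto with comp.
  by apply: Sigma_ext (Sigma_preimage cp sS) => n; rewrite !npairE.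
by move=> /Sigma1_ce/cohC[].
Qed.

(** * Indices of the elements of the cohesive product *)

(** Program [e] is cut down to the outputs that lie in the structure [A n], so
    that every index is the index of a function with values in the right
    domains. *)
Definition index_value L (A : nat -> nat_structure L) (e n y : nat) : Prop :=
  index_eval e n y /\ dom (A n) y.

Lemma index_value_fun L (A : nat -> nat_structure L) e n y y' :
  index_value A e n y -> index_value A e n y' -> y = y'.
Proof. by move=> [ey _] [ey' _]; exact: eval_fun ey ey'. Qed.

Lemma set_typeP (T : Type) (B : set T) x : B x <-> exists b : B, val b = x.
Proof.
split=> [Bx|[b <-]]; last exact: set_valP.
by exists (SigSub (mem_set Bx)).
Qed.

Lemma comp_dom L (A : nat -> nat_structure L) : uniformly_computable A ->
  computable (fun z => `[< dom (A (nfst z)) (nsnd z) >]).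
Proof.
move=> /uc_dom; congr computable; apply/funext => z.
congr nat_of_bool; apply/idP/asboolP; rewrite in_setE /=.
  by move=> [n [a ->]]; rewrite !npairE; exact: set_valP.
by move=> /set_typeP[a az]; exists (nfst z), a; rewrite az npair_eta.
Qed.

Lemma Sigma_dom L (A : nat -> nat_structure L) k f g : uniformly_computable A ->
  computable f -> computable g -> Sigma_set k (fun z => dom (A (f z)) (g z)).
Proof.
move=> hA cf cg; have cp := comp_npair cf cg.
apply: Sigma_ext (Sigma_preimage cp (Sigma_bool k (comp_dom hA))) => z.
by rewrite !npairE; split=> /asboolP.
Qed.

Lemma Sigma_index_value L (A : nat -> nat_structure L) f g h :
  uniformly_computable A ->
  computable f -> computable g -> computable h ->
  Sigma_set 1 (fun z => index_value A (f z) (g z) (h z)).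
Proof.
by move=> hA cf cg ch; apply: Sigma_and;
  [exact: Sigma_index_eval|exact: Sigma_dom].
Qed.

(** Whether a value exists is decided classically; this is compatible with
    partial computability because divergence is allowed. *)
Definition index_pfun L (A : nat -> nat_structure L) (e n : nat) :
    option (A n) :=
  if pselect (exists a : A n, index_value A e n (val a)) is left ex
  then Some (projT1 (cid ex)) else None.

Lemma index_pfunP L (A : nat -> nat_structure L) e n a :
  index_pfun A e n = Some a <-> index_value A e n (val a).
Proof.
rewrite /index_pfun; case: pselect => [ex|nex]; last first.
  by split=> // va; case: nex; exists a.
case: cid => b vb /=; split=> [[<-] //|va].
by congr Some; apply: val_inj; exact: index_value_fun vb va.
Qed.

Lemma index_value_ex L (A : nat -> nat_structure L) e n y :
  index_value A e n y ->
  exists2 a, index_pfun A e n = Some a & val a = y.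
Proof.
move=> vy; have [_ /set_typeP[a ay]] := vy.
by exists a => //; apply/index_pfunP; rewrite ay.
Qed.

Lemma index_pfun_computable L (A : nat -> nat_structure L) e :
  uniformly_computable A ->
  partial_computable (fun n => omap val (index_pfun A e n)).
Proof.
move=> hA; apply: Sigma1_partial_computable.
have sv : Sigma_set 1 (fun z => index_value A e (nfst z) (nsnd z)).
  by apply: Sigma_index_value => //; auto with comp.
apply: Sigma_ext sv => z; split=> [/index_value_ex[a -> <-] //|].
by case E: (index_pfun A e (nfst z)) => [a|] //= [<-]; apply/index_pfunP.
Qed.

(** The outputs of a program for [phi] already lie in the right domains, and
    cutting down does not change them. *)
Lemma index_pfun_surj L (A : nat -> nat_structure L) C (phi : cfun A C) :
  exists e, forall n, index_pfun A e n = phi n.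
Proof.
have [c Hc] := cfun_comp phi; have [e Ee] := decode_surj c; exists e => n.
have evE y : index_eval e n y <-> omap val (phi n) = Some y
  by rewrite /index_eval Ee.
case E: (phi n) evE => [a|] /= evE.
  by apply/index_pfunP; split; [exact/evE|exact: set_valP].
case E' : (index_pfun A e n) => [a|] //.
by have /index_pfunP[/evE] := E'.
Qed.

Definition almost_total L (A : nat -> nat_structure L) C (e : nat) : Prop :=
  almost_sub C [set n | exists y, index_value A e n y].

Definition index_eq L (A : nat -> nat_structure L) C (i e : nat) : Prop :=
  almost_sub C [set n | exists y, index_value A i n y /\ index_value A e n y].

Definition least_index L (A : nat -> nat_structure L) C : set nat :=
  [set e | almost_total A C e /\ forall i, i < e -> ~ index_eq A C i e].

Lemma index_dom L (A : nat -> nat_structure L) C e : almost_total A C e ->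
  almost_sub C [set n | index_pfun A e n].
Proof. by apply: almost_subS => n [y /index_value_ex[a /= ->]]. Qed.

Definition index_cfun L (A : nat -> nat_structure L) C
    (hA : uniformly_computable A) e (te : almost_total A C e) : cfun A C :=
  CFun (index_pfun_computable e hA) (index_dom te).

Lemma index_eqP L (A : nat -> nat_structure L) C (hA : uniformly_computable A)
    i e (ti : almost_total A C i) (te : almost_total A C e) :
  \pi_(cprod A C) (index_cfun hA ti) = \pi_(cprod A C) (index_cfun hA te) <->
  index_eq A C i e.
Proof.
rewrite cprod_eqP; split; apply: almost_subS => n /=.
  by move=> [a /index_pfunP va /index_pfunP va']; exists (val a).
move=> [y [/index_value_ex[a /= ia <-] va]]; exists a => //=.
by apply/index_pfunP.
Qed.

Definition least_cfun L (A : nat -> nat_structure L) C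
    (hA : uniformly_computable A) (e : least_index A C) : cfun A C :=
  index_cfun hA (set_valP e).1.

Definition least_class L (A : nat -> nat_structure L) C
    (hA : uniformly_computable A) (e : least_index A C) : cprod A C :=
  \pi_(cprod A C) (least_cfun hA e).

Lemma least_class_inj L (A : nat -> nat_structure L) C
    (hA : uniformly_computable A) : injective (@least_class L A C hA).
Proof.
move=> i e /index_eqP ie; apply: val_inj.
have ei : index_eq A C (val e) (val i).
  by apply: almost_subS ie => n [y [? ?]]; exists y.
by case: (ltngtP (val i) (val e)) => // [/(set_valP e).2|/(set_valP i).2].
Qed.

Lemma least_class_surj L (A : nat -> nat_structure L) C
    (hA : uniformly_computable A) (X : cprod A C) :
  exists e, least_class hA e = X.
Proof.
rewrite -(reprK X); move: (repr X) => phi {X}.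
pose P e := `[< exists te : almost_total A C e,
  \pi_(cprod A C) (index_cfun hA te) = \pi_(cprod A C) phi >].
have exP : exists e, P e.
  have [e ephi] := index_pfun_surj phi; exists e; apply/asboolP.
  have te : almost_total A C e.
    apply: almost_subS (cfun_dom phi) => n /=; rewrite -ephi.
    by case E: (index_pfun A e n) => [a|] // _; exists (val a);
      apply/index_pfunP.
  exists te; apply/cprod_eqP; apply: almost_subS (cfun_dom phi) => n /=.
  by rewrite /eqC_set /= ephi; case: (phi n) => // a _; exists a.
case: (ex_minnP exP) => e /asboolP[te Ee] mine.
have le : least_index A C e.
  split=> // i lti ie; suff : P i by move/mine; rewrite leqNgt lti.
  have ti : almost_total A C i.
    by apply: almost_subS ie => n [y [? _]]; exists y.
  by apply/asboolP; exists ti; rewrite -Ee; apply/index_eqP.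
have [e' Ee'] := (set_typeP _ _).1 le; exists e'; rewrite -Ee.
apply/index_eqP; rewrite Ee'.
by apply: almost_subS (te) => n [y ?]; exists y.
Qed.

Lemma least_class_bij L (A : nat -> nat_structure L) C
    (hA : uniformly_computable A) : bijective (@least_class L A C hA).
Proof.
have [g gK] := choice (least_class_surj hA (C := C)).
by exists g => // e; apply: (@least_class_inj _ _ _ hA); rewrite gK.
Qed.

(** The product is not empty: the least element of [A n] is computable from [n]
    by search, uniformly. *)
Lemma cfun_exists L (A : nat -> nat_structure L) C :
  uniformly_computable A -> exists phi : cfun A C, True.
Proof.
move=> hA.
have ex n : exists y, `[< dom (A n) y >].
  by have [y Ay] := dom_nonempty (A n); exists y; apply/asboolP.
pose m n := ex_minn (ex n).
have cm : partial_computable (fun n => Some (m n)).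
  apply: Sigma1_partial_computable.
  apply: (@Sigma_ext _ (fun z => dom (A (nfst z)) (nsnd z) /\
      forall i, i < nsnd z -> ~ dom (A (nfst z)) i)).
    move=> z; rewrite /m; case: ex_minnP => y /asboolP Ay miny; split.
      move=> [Az minz]; congr Some; apply/eqP;
        rewrite eqn_leq (miny _ (asboolT Az)).
      by rewrite leqNgt; apply/negP => /minz.
    move=> [<-]; split=> // i lti Ai.
    by have := miny i (asboolT Ai); rewrite leqNgt lti.
  apply: Sigma_and; first by apply: Sigma_dom; auto with comp.
  apply: (@Sigma_ball _ (fun z i => ~ dom (A (nfst z)) i));
    first by auto with comp.
  have cp : computable (fun z => npair (nfst (nfst z)) (nsnd z))
    by auto with comp.
  apply: Sigma_ext (Sigma_preimage cp (Sigma_bool 1 (comp_neg (comp_dom hA))))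
    => z.
  by rewrite !npairE; split=> /asboolPn.
have Am n : dom (A n) (m n) by rewrite /m; case: ex_minnP => y /asboolP.
pose phi n : option (A n) := Some (SigSub (mem_set (Am n))).
have dphi : almost_sub C [set n | phi n].
  by rewrite /almost_sub (_ : _ `\` _ = set0) // -subset0 => n [_ []].
by exists (@CFun L A C phi cm dphi).
Qed.

Lemma least_index_nonempty L (A : nat -> nat_structure L) C :
  uniformly_computable A -> least_index A C !=set0.
Proof.
move=> hA; have [phi _] := @cfun_exists L A C hA.
have [e _] := least_class_surj hA (\pi_(cprod A C) phi).
by exists (val e); exact: set_valP.
Qed.

(** * Atomic formulas in the cohesive product *)

Lemma code_argsK (B : set nat) m (t : m.-tuple B) :
  unseq (code_args t) = map val t.
Proof. exact: code_seqK. Qed.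

Lemma size_code_args (B : set nat) m (t : m.-tuple B) :
  size (unseq (code_args t)) = m.
Proof. by rewrite code_argsK size_map size_tuple. Qed.

Lemma nth_code_args (B : set nat) m (t : m.-tuple B) (i : 'I_m) :
  nth 0 (unseq (code_args t)) i = val (tnth t i).
Proof.
by rewrite code_argsK -[map val t]/(tval (map_tuple val t)) -tnth_nth tnth_map.
Qed.

Lemma code_args_surj (B : set nat) m w : size (unseq w) = m ->
  (forall i, i < m -> B (nth 0 (unseq w) i)) ->
  exists t : m.-tuple B, code_args t = w.
Proof.
move=> sw Bw.
have b_ex (i : 'I_m) : exists b : B, val b = nth 0 (unseq w) i.
  by apply: (set_typeP B _).1; apply: Bw; exact: ltn_ord.
have [b bE] := choice b_ex; exists [tuple b i | i < m].
rewrite -[RHS]unseqK; congr code_seq.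
apply: (@eq_from_nth _ 0); rewrite size_map size_tuple //.
move=> i lti; have := nth_code_args [tuple b i | i < m] (Ordinal lti).
by rewrite tnth_mktuple bE code_argsK.
Qed.

(** The sequence coded by [v] lists the values at [n] of the functions whose
    indices are listed by [w]. *)
Definition pointwise L (A : nat -> nat_structure L) (w n v : nat) : Prop :=
  size (unseq v) = size (unseq w) /\
  forall i, i < size (unseq w) ->
    index_value A (nth 0 (unseq w) i) n (nth 0 (unseq v) i).

Lemma Sigma_pointwise L (A : nat -> nat_structure L) f g h :
  uniformly_computable A ->
  computable f -> computable g -> computable h ->
  Sigma_set 1 (fun z => pointwise A (f z) (g z) (h z)).
Proof.
move=> hA cf cg ch; apply: Sigma_and; first by apply: Sigma_eq; auto with comp.
have c1 k : computable k -> computable (fun z => k (nfst z)).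
  by move=> ck; apply: (comp_comp ck); auto with comp.
have cf1 := c1 _ cf; have cg1 := c1 _ cg; have ch1 := c1 _ ch.
apply: (@Sigma_ball _ (fun z i =>
    index_value A (nth 0 (unseq (f z)) i) (g z) (nth 0 (unseq (h z)) i))).
  by auto with comp.
by apply: Sigma_index_value; auto with comp.
Qed.

Lemma values_pointwise L (A : nat -> nat_structure L) C
    (hA : uniformly_computable A) m (t : m.-tuple (least_index A C)) n u :
  values (map_tuple (least_cfun hA) t) n = Some u <->
  pointwise A (code_args t) n (code_args u).
Proof.
rewrite valuesP /pointwise !size_code_args; split=> [H|[_ H] i].
  split=> // i lti.
  rewrite (nth_code_args t (Ordinal lti)) (nth_code_args u (Ordinal lti)).
  by apply/index_pfunP; rewrite -H tnth_map.
rewrite tnth_map; apply/index_pfunP.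
by have := H i (ltn_ord i); rewrite !nth_code_args.
Qed.

Lemma pointwise_tuple L (A : nat -> nat_structure L) (B : set nat) m
    (t : m.-tuple B) n v :
  pointwise A (code_args t) n v -> exists u : m.-tuple (A n), code_args u = v.
Proof.
rewrite /pointwise size_code_args => -[sv H].
by apply: code_args_surj => // i lti; case: (H i lti).
Qed.

(** The three conditions below are the sets of [n] at which an atomic formula
    about indices holds in [A n]. They speak of codes only, so that they are
    uniformly [Sigma_1] in the symbol and the indices. *)
Definition rel_condition L (A : nat -> nat_structure L) (s w n : nat) : Prop :=
  exists v, [set x | exists n (s : rel_sym L) (t : (rel_arity s).-tuple (A n)),
      rel_interp (str (A n)) t /\ x = npair n (npair (val s) (code_args t))]
    (npair n (npair s v)) /\ pointwise A w n v.

Definition fun_condition L (A : nat -> nat_structure L) (f : nat -> option nat)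
    (s w y n : nat) : Prop :=
  exists v z, f (npair n (npair s v)) = Some z /\
              (pointwise A w n v /\ index_value A y n z).

Definition const_condition L (A : nat -> nat_structure L)
    (f : nat -> option nat) (s y n : nat) : Prop :=
  exists z, f (npair n s) = Some z /\ index_value A y n z.

(** That [s] is a relation symbol with as many arguments as there are indices
    can be read off at any single [n], and an infinite [C] provides one. *)
Lemma rel_symbol_condition L (A : nat -> nat_structure L) (s w n : nat) :
  rel_condition A s w n -> exists s' : rel_sym L,
  val s' = s /\ rel_arity s' = size (unseq w).
Proof.
move=> [v [[n' [s' [t [_ /npair_inj[En /npair_inj[Es Ev]]]]]] [sv _]]].
by exists s'; rewrite -sv Ev size_code_args.
Qed.

Lemma least_class_relE L (A : nat -> nat_structure L)
    (hA : uniformly_computable A) C (s : rel_sym L)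
    (t : (rel_arity s).-tuple (least_index A C)) :
  rel_interp (cohesive_product hA C) (map_tuple (least_class hA) t) <->
  almost_sub C [set n | rel_condition A (val s) (code_args t) n].
Proof.
rewrite (_ : map_tuple _ t =
    map_tuple \pi_(cprod A C) (map_tuple (least_cfun hA) t)); last first.
  by apply: eq_from_tnth => i; rewrite !tnth_map.
rewrite cprod_relE; split; apply: almost_subS => n /=.
  move=> [u /values_pointwise pu ru]; exists (code_args u); split=> //.
  by exists n, s, u.
move=> [v [[n' [s' [t' [rt /npair_inj[En /npair_inj[Es Ev]]]]]] pv]].
subst n'; have Es' : s = s' by apply: val_inj.
subst s'; exists t' => //; apply/values_pointwise; by rewrite -Ev.
Qed.

Lemma least_class_funE L (A : nat -> nat_structure L)
    (hA : uniformly_computable A) C f (s : fun_sym L)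
    (t : (fun_arity s).-tuple (least_index A C)) (y : least_index A C) :
  (forall n (s : fun_sym L) (t : (fun_arity s).-tuple (A n)),
      f (npair n (npair (val s) (code_args t))) =
        Some (val (fun_interp (str (A n)) t))) ->
  fun_interp (cohesive_product hA C) (map_tuple (least_class hA) t) =
    least_class hA y <->
  almost_sub C [set n | fun_condition A f (val s) (code_args t) (val y) n].
Proof.
move=> fE; rewrite (_ : map_tuple _ t =
    map_tuple \pi_(cprod A C) (map_tuple (least_cfun hA) t)); last first.
  by apply: eq_from_tnth => i; rewrite !tnth_map.
rewrite cprod_funE cprod_eqP; split; apply: almost_subS => n /=.
  move=> [a] /=; case E: (values _ n) => [u|] //= [<-] /index_pfunP vy.
  exists (code_args u), (val (fun_interp (str (A n)) u)); rewrite fE;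
    split=> //.
  by split=> //; apply/values_pointwise.
move=> [v [z [fz [pv vy]]]]; have [u uv] := pointwise_tuple pv.
subst v; move: fz; rewrite fE => -[zE].
exists (fun_interp (str (A n)) u) => /=.
  by move/values_pointwise: pv => ->.
by apply/index_pfunP; rewrite [val _]zE.
Qed.

Lemma least_class_constE L (A : nat -> nat_structure L)
    (hA : uniformly_computable A) C f (s : const_sym L) (y : least_index A C) :
  (forall n (s : const_sym L),
      f (npair n (val s)) = Some (val (const_interp (str (A n)) s))) ->
  const_interp (cohesive_product hA C) s = least_class hA y <->
  almost_sub C [set n | const_condition A f (val s) (val y) n].
Proof.
move=> fE; rewrite /= cprod_eqP; split; apply: almost_subS => n /=.
  move=> [a] /= [<-] /index_pfunP vy.
  by exists (val (const_interp (str (A n)) s)); rewrite fE.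
move=> [z []]; rewrite fE => -[<-] vy; exists (const_interp (str (A n)) s) =>
  //=.
exact/index_pfunP.
Qed.

(** * The presentation and its diagram *)

Definition transport L (B : set nat) (B0 : B !=set0) M (SM : structure_on L M)
    (f : B -> M) (g : M -> B) : nat_structure L :=
  NatStructure B0 (StructureOn
    (fun s t => rel_interp SM (map_tuple f t))
    (fun s t => g (fun_interp SM (map_tuple f t)))
    (fun s => g (const_interp SM s))).

Lemma transport_presentation L (B : set nat) (B0 : B !=set0) M
    (SM : structure_on L M) (f : B -> M) (g : M -> B) :
  cancel f g -> cancel g f -> presentation (transport B0 SM f g) SM.
Proof.
move=> fK gK; exists f; split=> //=; first by exists g.
Qed.

Lemma Delta_least_index L (A : nat -> nat_structure L) C k : 1 < k ->
  uniformly_computable A -> cohesive C -> Sigma_set k C ->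
  Delta_set k.+1 (least_index A C).
Proof.
move=> hk hA hC sC; apply: Delta_and.
  apply: (@Delta_almost_sub _ _ (fun e n => exists y, index_value A e n y)) =>
    //.
  by apply: Sigma_ex; apply: Sigma_index_value; auto with comp.
apply: (@Delta_ball _ (fun e i => ~ index_eq A C i e)); first by auto with comp.
apply: Delta_not.
apply: (@Delta_almost_sub _ _ (fun p n => exists y,
  index_value A (nsnd p) n y /\ index_value A (nfst p) n y)) => //.
by apply: Sigma_ex; apply: Sigma_and; apply: Sigma_index_value; auto with comp.
Qed.

Lemma Delta_args k (B : set nat) f : computable f -> Delta_set k.+1 B ->
  Delta_set k.+1 (fun x =>
    forall i, i < size (unseq (f x)) -> B (nth 0 (unseq (f x)) i)).
Proof.
move=> cf dB; apply: (@Delta_ball _ (fun x i => B (nth 0 (unseq (f x)) i))).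
  by auto with comp.
apply: Delta_preimage dB; have : computable (fun z => f (nfst z)).
  by apply: comp_comp cf _; auto with comp.
by auto with comp.
Qed.

Definition least_structure L (A : nat -> nat_structure L)
    (hA : uniformly_computable A) C (g : cprod A C -> least_index A C) :=
  transport (least_index_nonempty C hA) (cohesive_product hA C)
    (least_class hA) g.

(** The four parts of the diagram are described by conditions on the components
    of a number, without quantifiers over symbols or tuples of elements. *)
Lemma diagram_domP L (N : nat_structure L) x :
  (exists a : N, x = npair 0 (val a)) <-> nfst x = 0 /\ dom N (nsnd x).
Proof.
split=> [[a ->]|[x0 /set_typeP[a ax]]].
  by rewrite !npairE; split=> //; exact: set_valP.
by exists a; rewrite ax -x0 npair_eta.
Qed.

Lemma diagram_relP L (A : nat -> nat_structure L) (hA : uniformly_computable A)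
    C (g : cprod A C -> least_index A C) x :
  infinite_set C ->
  (exists (s : rel_sym L) (t : (rel_arity s).-tuple (least_structure hA g)),
      rel_interp (str (least_structure hA g)) t /\
      x = npair 1 (npair (val s) (code_args t))) <->
  nfst x = 1 /\
  ((forall i, i < size (unseq (nsnd (nsnd x))) ->
     least_index A C (nth 0 (unseq (nsnd (nsnd x))) i)) /\
   almost_sub C
     [set n | rel_condition A (nfst (nsnd x)) (nsnd (nsnd x)) n]).
Proof.
move=> infC; split.
  move=> [s [t [/= /least_class_relE rt ->]]]; rewrite !npairE; split=> //.
  split=> // i; rewrite size_code_args => lti.
  by rewrite (nth_code_args t (Ordinal lti)); exact: set_valP.
have : x = npair (nfst x) (npair (nfst (nsnd x)) (nsnd (nsnd x))).
  by rewrite !npair_eta.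
move: (nfst x) (nfst (nsnd x)) (nsnd (nsnd x)) => i s w -> [-> [Bw sw]].
have [n /rel_symbol_condition[s' [Es sz]]] := almost_sub_ex infC sw.
rewrite -sz in Bw; have [t Et] := code_args_surj (esym sz) Bw.
subst s w; exists s', t; split=> //.
exact/(least_class_relE hA).
Qed.

Lemma diagram_funP L (A : nat -> nat_structure L) (hA : uniformly_computable A)
    C (g : cprod A C -> least_index A C) (f ar : nat -> option nat) x :
  cancel (least_class hA) g -> cancel g (least_class hA) ->
  (forall n (s : fun_sym L) (t : (fun_arity s).-tuple (A n)),
      f (npair n (npair (val s) (code_args t))) =
        Some (val (fun_interp (str (A n)) t))) ->
  (forall s : fun_sym L, ar (val s) = Some (fun_arity s)) ->
  (exists (s : fun_sym L) (t : (fun_arity s).-tuple (least_structure hA g)),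
      x = npair 2 (npair (val s) (npair (code_args t)
            (val (fun_interp (str (least_structure hA g)) t))))) <->
  nfst x = 2 /\
  ((fun_sym L (nfst (nsnd x)) /\
    ar (nfst (nsnd x)) = Some (size (unseq (nfst (nsnd (nsnd x)))))) /\
   (((forall i, i < size (unseq (nfst (nsnd (nsnd x)))) ->
       least_index A C (nth 0 (unseq (nfst (nsnd (nsnd x)))) i)) /\
     least_index A C (nsnd (nsnd (nsnd x)))) /\
    almost_sub C [set n | fun_condition A f (nfst (nsnd x))
      (nfst (nsnd (nsnd x))) (nsnd (nsnd (nsnd x))) n])).
Proof.
move=> fgK gK fE arE; split.
  move=> [s [t ->]]; rewrite !npairE; split=> //; split; first split.
  - exact: set_valP.
  - by rewrite size_code_args.
  split; first split.
  - move=> i; rewrite size_code_args => lti.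
    by rewrite (nth_code_args t (Ordinal lti)); exact: set_valP.
  - exact: set_valP.
  by apply/(least_class_funE hA _ _ fE); rewrite /= gK.
have : x = npair (nfst x) (npair (nfst (nsnd x))
    (npair (nfst (nsnd (nsnd x))) (nsnd (nsnd (nsnd x))))).
  by rewrite !npair_eta.
move: (nfst x) (nfst (nsnd x)) (nfst (nsnd (nsnd x))) (nsnd (nsnd (nsnd x))).
move=> i s w y -> [-> [[/set_typeP[s' Es] sz] [[Bw /set_typeP[y' Ey]]]]].
subst s y; move: sz; rewrite arE => -[sz].
rewrite -sz in Bw; have [t Et] := code_args_surj (esym sz) Bw.
subst w => /(least_class_funE hA _ _ fE) ty; exists s', t.
congr (npair _ (npair _ (npair _ (val _)))); exact: canRL fgK (esym ty).
Qed.

Lemma diagram_constP L (A : nat -> nat_structure L)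
    (hA : uniformly_computable A) C (g : cprod A C -> least_index A C)
    (f : nat -> option nat) x :
  cancel (least_class hA) g -> cancel g (least_class hA) ->
  (forall n (s : const_sym L),
      f (npair n (val s)) = Some (val (const_interp (str (A n)) s))) ->
  (exists s : const_sym L,
      x = npair 3 (npair (val s)
            (val (const_interp (str (least_structure hA g)) s)))) <->
  nfst x = 3 /\
  (const_sym L (nfst (nsnd x)) /\
   (least_index A C (nsnd (nsnd x)) /\
    almost_sub C [set n |
      const_condition A f (nfst (nsnd x)) (nsnd (nsnd x)) n])).
Proof.
move=> fgK gK fE; split.
  move=> [s ->]; rewrite !npairE; split=> //; split; first exact: set_valP.
  split; first exact: set_valP.
  by apply/(least_class_constE hA _ _ fE); rewrite /= gK.
have : x = npair (nfst x) (npair (nfst (nsnd x)) (nsnd (nsnd x))).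
  by rewrite !npair_eta.
move: (nfst x) (nfst (nsnd x)) (nsnd (nsnd x)) => i s y ->
  [-> [/set_typeP[s' Es] [/set_typeP[y' Ey]]]].
subst s y => /(least_class_constE hA _ _ fE) sy; exists s'.
congr (npair _ (npair _ (val _))); exact: canRL fgK (esym sy).
Qed.

Lemma Sigma_computable_set k B f : computable_set B -> computable f ->
  Sigma_set k (fun x => B (f x)).
Proof.
by move=> cB cf; apply: (Sigma_preimage cf); apply: (@Sigma_le 0).
Qed.

Lemma Sigma_rel_condition L (A : nat -> nat_structure L) :
  uniformly_computable A ->
  Sigma_set 1 (fun z =>
    rel_condition A (nfst (nfst z)) (nsnd (nfst z)) (nsnd z)).
Proof.
move=> hA; apply: Sigma_ex; apply: Sigma_and.
  apply: (@Sigma_computable_set _ _ (fun z => npair (nsnd (nfst z))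
    (npair (nfst (nfst (nfst z))) (nsnd z)))); last by auto 10 with comp.
  exact: uc_rel hA.
by apply: Sigma_pointwise; auto with comp.
Qed.

Lemma Sigma_fun_condition L (A : nat -> nat_structure L) f :
  uniformly_computable A -> partial_computable f ->
  Sigma_set 1 (fun z => fun_condition A f (nfst (nfst z))
    (nfst (nsnd (nfst z))) (nsnd (nsnd (nfst z))) (nsnd z)).
Proof.
move=> hA cf; do 2!apply: Sigma_ex; apply: Sigma_and.
  by apply: Sigma_graph => //; auto 10 with comp.
by apply: Sigma_and; [apply: Sigma_pointwise|apply: Sigma_index_value];
  auto 10 with comp.
Qed.

Lemma Sigma_const_condition L (A : nat -> nat_structure L) f :
  uniformly_computable A -> partial_computable f ->
  Sigma_set 1 (fun z =>
    const_condition A f (nfst (nfst z)) (nsnd (nfst z)) (nsnd z)).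
Proof.
move=> hA cf; apply: Sigma_ex; apply: Sigma_and.
  by apply: Sigma_graph => //; auto 10 with comp.
by apply: Sigma_index_value; auto 10 with comp.
Qed.

Lemma Delta_or4 k (P Q R S : set nat) :
  Delta_set k P -> Delta_set k Q -> Delta_set k R -> Delta_set k S ->
  Delta_set k (fun x => [\/ P x, Q x, R x | S x]).
Proof.
move=> dP dQ dR dS.
apply: Delta_ext (Delta_or (Delta_or dP dQ) (Delta_or dR dS)) => x.
split=> [[[?|?]|[?|?]]|[?|?|?|?]];
  [constructor 1|constructor 2|constructor 3|constructor 4|
   left; left|left; right|right; left|right; right]; by [].
Qed.

Theorem proposition3p2 (L : language) (hL : computable_language L)
    (A : nat -> nat_structure L) (hA : uniformly_computable A)
    (C : set nat) (k : nat) (hk : 2 <= k)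
    (hC : cohesive C) (hCk : Delta_set k C) :
  exists N : nat_structure L,
    presentation N (cohesive_product hA C) /\ Delta_structure k.+1 N.
Proof.
have [sC _] := hCk; have infC := hC.1.
have [g fgK gK] := least_class_bij C hA.
exists (least_structure hA g); split; first exact: transport_presentation.
have [f cf fE] := uc_func hA; have [h ch hE] := uc_const hA.
have [ar car arE] := comp_fun_arity hL.
have dN : Delta_set k.+1 (least_index A C) by exact: Delta_least_index.
have deq m : Delta_set k.+1 (fun x => nfst x = m).
  by apply: (@Sigma_Delta 0) => //; apply: Sigma_eq; auto with comp.
have domD g' : computable g' ->
  Delta_set k.+1 (fun x => least_index A C (g' x)).
  by move=> cg; exact: (Delta_preimage cg dN).
have almostD c (S : nat -> nat -> Prop) : computable c ->
    Sigma_set 1 (fun z => S (nfst z) (nsnd z)) ->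
    Delta_set k.+1 (fun x => almost_sub C [set n | S (c x) n]).
  by move=> cc sS; apply: (@Delta_preimage _ (fun p =>
    almost_sub C [set n | S p n]) _ cc); exact: Delta_almost_sub.
apply: Delta_or4.
- apply: Delta_ext (fun x => iff_sym (diagram_domP (least_structure hA g) x)) _.
  by apply: Delta_and => //; apply: domD; auto with comp.
- apply: Delta_ext (fun x => iff_sym (diagram_relP hA g x infC)) _.
  apply: Delta_and => //; apply: Delta_and.
    by apply: Delta_args => //; auto with comp.
  apply: (almostD nsnd (fun p n => rel_condition A (nfst p) (nsnd p) n)).
    by auto with comp.
  exact: Sigma_rel_condition.
- apply: Delta_ext (fun x => iff_sym (diagram_funP x fgK gK fE arE)) _.
  apply: Delta_and => //; apply: Delta_and; first apply: Delta_and.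
  + apply: (@Sigma_Delta 0) => //; apply: Sigma_computable_set; auto with comp.
    exact: comp_fun_sym hL.
  + apply: (@Sigma_Delta 1); first exact: ltnW.
    by apply: Sigma_graph => //; auto with comp.
  apply: Delta_and.
    apply: Delta_and; last by apply: domD; auto with comp.
    by apply: Delta_args => //; auto with comp.
  apply: (almostD nsnd (fun p n =>
    fun_condition A f (nfst p) (nfst (nsnd p)) (nsnd (nsnd p)) n)).
    by auto with comp.
  exact: Sigma_fun_condition.
- apply: Delta_ext (fun x => iff_sym (diagram_constP x fgK gK hE)) _.
  apply: Delta_and => //; apply: Delta_and.
    apply: (@Sigma_Delta 0) => //; apply: Sigma_computable_set; auto with comp.
    exact: comp_const_sym hL.
  apply: Delta_and; first by apply: domD; auto with comp.
  apply: (almostD nsnd (fun p n => const_condition A h (nfst p) (nsnd p) n)).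
    by auto with comp.
  exact: Sigma_const_condition.
Qed.
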